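(* (a) Let $H$ be a pre-Hilbert space and $\mathcal I=(H,\pi)$ a $\pi$-interacting Fock space, $\mathcal I\subset\overline{\mathscr F(H)}$, where the squeezing $\pi\colon(H\otimes\mathcal D_{\mathcal I})\oplus\Omega\mathbb C\to\mathcal D_{\mathcal I}$ is a weak projection with $\pi_1=\mathrm{id}_H$. Then, for all $n$, $$\pi_{n+1}\le\mathrm{id}_H\otimes\pi_n .\tag{i}$$ (b) Conversely, if $H$ is a pre-Hilbert space and $\pi\in\mathscr B(\overline{\mathscr F(H)})$ is a weak Fock projection such that the components $\pi_n$ fulfill (i) (and $\pi_1=\mathrm{id}_H$), then $\mathcal I:=\pi\mathscr F(H)$ is a $\pi$-interacting Fock space. (c) Moreover, in either case, among the summands $\pi_nH^{\otimes n}$ there exist coisometries $\pi_mH^{\otimes m}\otimes\pi_nH^{\otimes n}\to\pi_{m+n}H^{\otimes(m+n)}$ satisfying $\pi_mX_m\otimes\pi_nY_n\mapsto\pi_{m+n}(X_m\otimes Y_n)$ (so that the $\pi_n\overline{H^{\otimes n}}$ form a subproduct system and $\mathcal I$ is its associated interacting Fock space) if and only if the $\pi_n$ also fulfill $$\pi_{n+1}\le\pi_n\otimes\mathrm{id}_H\qquad\text{for all }n .$$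
   Context: All vector spaces are complex; $\oplus$ and $\otimes$ of pre-Hilbert spaces are algebraic; $\overline V$ is the completion of a pre-Hilbert space $V$; $\bar\otimes$ is the Hilbert space tensor product. $\mathscr F(H)=\Omega\mathbb C\oplus\bigoplus_{n\ge1}H^{\otimes n}$ is the algebraic full Fock space with its natural inner product, $\Omega$ a unit vector (the vacuum); $H^{\otimes0}=\Omega\mathbb C$; $\ell^*(x)\colon X\mapsto x\otimes X$ (with $x\otimes\Omega=x$) for $x\in H$. A map is a Fock map if it fixes $\Omega$ and preserves degree (elements of degree $n$ go to elements of $\overline{H^{\otimes n}}$); its $n$-th component carries the index $n$. A pre-Fock subspace of $\overline{\mathscr F(H)}$ is an algebraic direct sum $\mathcal I=\bigoplus_nH_n$ of subspaces $H_n\subset\overline{H^{\otimes n}}$ with $H_0=\Omega\mathbb C$; $\mathcal D_{\mathcal I}:=\mathcal I\oplus\mathcal I^\perp\subset\overline{\mathscr F(H)}$. A squeezing relative to $\mathcal I$ is a Fock map $\varkappa\colon(H\otimes\mathcal D_{\mathcal I})\oplus\Omega\mathbb C\to\mathcal D_{\mathcal I}$ that is onto $\mathcal I$ and vanishes on $H\otimes\mathcal I^\perp$. The $\varkappa$-interacting Fock space $(H,\varkappa)$ is $\mathcal I$ together with the creators $a^*(x)\colon\mathcal I\to\mathcal I$ ($x\in H$), the (co)restrictions of $\varkappa\ell^*(x)$. A projection $\pi$ on $\overline{\mathscr F(H)}$ is considered as a squeezing via its restriction to $(H\otimes\mathcal D_{\mathcal I})\oplus\Omega\mathbb C\subset\overline{\mathscr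 F(H)}$. A linear map $\pi$ from a pre-Hilbert space $V$ into $\overline V$ is a weak projection if $\langle x,\pi y\rangle=\langle\pi x,\pi y\rangle$ for all $x,y\in V$; it extends uniquely to an orthogonal projection on $\overline V$. A weak Fock projection is a weak projection that is a Fock map. The inequalities and the expressions $\pi_nH^{\otimes n}$ refer to the components $\pi_n$ of the extension of $\pi$ to a projection on $\overline{\mathscr F(H)}$ (and their restrictions); $\mathrm{id}_H\otimes\pi_n$ and $\pi_n\otimes\mathrm{id}_H$ are understood on $\overline{H^{\otimes(n+1)}}$. A coisometry between pre-Hilbert spaces $V$ and $W$ is a linear map $w\colon V\to W$ possessing an adjoint $w^*\colon W\to V$ that satisfies $ww^*=\mathrm{id}_W$. A subproduct system is a family $(K_n)_{n\in\mathbb N_0}$ of Hilbert spaces, $K_0=\mathbb C$, with coisometries $v_{m,n}\colon K_m\bar\otimes K_n\to K_{m+n}$ such that the product $x_my_n:=v_{m,n}(x_m\otimes y_n)$ is associative and $v_{n,0},v_{0,n}$ are the canonical identifications. Its associated interacting Fock space is the algebraic direct sum over $n\in\mathbb N_0$ of the dense subspaces $\mathrm{span}\,a^*(K_1)^n\Omega\subset K_n$ (with $\Omega=1\in K_0$), with creators $a^*(x)\colon X_n\mapsto xX_n$ for $x\in K_1$.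
   Formalization: In (c) the equivalence is for coisometries between completions; algebraic ones also need π_{m+n}H^{⊗(m+n)} ⊂ π_mH^{⊗m}⊗π_nH^{⊗n}. 𝓘 is the associated interacting Fock space with creators a*(x), x∈H; with x∈K_1 only for complete H. *)

(* Defs.v *)
From HB Require Import structures.
From mathcomp Require Import all_boot all_order all_algebra.
From mathcomp Require Import complex.
From mathcomp Require Import all_classical all_reals all_analysis.

Set Implicit Arguments.
Unset Strict Implicit.
Unset Printing Implicit Defensive.

Import Order.TTheory GRing.Theory Num.Theory Num.Def.
Import numFieldNormedType.Exports.

Local Open Scope classical_set_scope.
Local Open Scope ring_scope.

(* [ip] is linear in the first and antilinear in the second argument, so that
   <x, y> in the convention "antilinear on the left" is [ip y x]. *)
Record preHilbert (R : realType) := PreHilbert {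
  psort :> normedModType R[i];
  ip : {dot psort for conjC};
  norm_ip : forall x, `|x| ^+ 2 = ip x x
}.

Definition hilbert (R : realType) (V : preHilbert R) :=
  forall G : set_system V, ProperFilter G -> cauchy G -> cvg G.

Section LinearSubspaces.
Variables (K : numFieldType) (V : lmodType K).

Definition lsubspace (S : set V) :=
  S 0 /\ forall (a : K) x y, S x -> S y -> S (a *: x + y).

Definition lspan (A : set V) : set V := smallest lsubspace A.

Definition linear_on (S : set V) (f : V -> V) :=
  forall (a : K) x y, S x -> S y -> f (a *: x + y) = a *: f x + f y.

End LinearSubspaces.

Section TensorPowers.
Variables (R : realType) (H F : preHilbert R) (word : seq H -> F).

Definition gen_tpow (n : nat) : set F :=
  lspan [set word s | s in [set s : seq H | size s = n]].

Definition gen_ctpow (n : nat) : set F := closure (gen_tpow n).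

End TensorPowers.

(* The completed full Fock space of H, given up to unitary isomorphism by
   its elementary tensors [word [:: x1; ...; xn]] = x1 (x) ... (x) xn (so that
   [word [::]] is the vacuum) and by the tensor product [tens] of an element
   of the n-th (completed) summand with an arbitrary element; [tens X Y] is
   meaningless when X is not homogeneous.  Multilinearity of [word], and
   bilinearity of [tens] on its domain, follow from the inner products. *)
Record fockSpace (R : realType) (H : preHilbert R) := FockSpace {
  fsort :> preHilbert R;
  fsort_hilbert : hilbert fsort;
  word : seq H -> fsort;
  ip_word : forall s t, ip fsort (word s) (word t) =
    if size s == size t then \prod_(p <- zip s t) ip H p.1 p.2 else 0;
  word_dense : closure (lspan (range word)) = setT;
  tens : fsort -> fsort -> fsort;
  tens_word : forall s t, tens (word s) (word t) = word (s ++ t);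
  ip_tens : forall n X X' Y Y', gen_ctpow word n X -> gen_ctpow word n X' ->
    ip fsort (tens X Y) (tens X' Y') = ip fsort X X' * ip fsort Y Y'
}.

Section InteractingFock.
Variables (R : realType) (H : preHilbert R) (F : fockSpace H).
Implicit Types (V W I A : set F) (p w P T : F -> F).

Definition vac : F := word F [::].

(* [tpow n] is the algebraic tensor power, [ctpow n] its completion and
   [afock] the algebraic full Fock space. *)
Definition tpow (n : nat) : set F := gen_tpow (word F) n.
Definition ctpow (n : nat) : set F := gen_ctpow (word F) n.
Definition afock : set F := lspan (range (word F)).

Definition ell (x : H) (X : F) : F := tens (word F [:: x]) X.

(* The algebraic tensor product of two subspaces V, W, where V consists of
   elements of the same degree, realized inside F. *)
Definition atens V W : set F := lspan [set tens x y | x in V & y in W].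

Definition orth A : set F := [set x | forall y, A y -> ip F x y = 0].

(* Maps defined on a subspace V of F only are represented by total functions
   whose values outside V are irrelevant. *)

Definition fock_map V p :=
  p vac = vac /\ forall n X, V X -> ctpow n X -> ctpow n (p X).

Definition weak_projection V p :=
  [/\ linear_on V p, forall x, V x -> closure V (p x)
    & forall x y, V x -> V y -> ip F x (p y) = ip F (p x) (p y)].

Definition orthogonal_projection P :=
  [/\ linear P, forall x, P (P x) = P x
    & forall x y, ip F (P x) y = ip F x (P y)].

Definition projection_extension V p P :=
  orthogonal_projection P /\ forall x, V x -> P x = p x.

Definition pre_fock I :=
  exists Hn : nat -> set F,
    [/\ forall n, lsubspace (Hn n), forall n, Hn n `<=` ctpow n,
        Hn 0%N = lspan [set vac] & I = lspan (\bigcup_n Hn n)].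

Definition ddom I : set F := [set x + y | x in I & y in orth I].

(* (H (x) D_I) (+) Omega C as a subspace of F. *)
Definition sqdom I : set F :=
  lspan ([set ell x X | x in [set: H] & X in ddom I] `|` [set vac]).

Definition squeezing I p :=
  [/\ linear_on (sqdom I) p, fock_map (sqdom I) p, p @` sqdom I = I
    & forall x X, orth I X -> p (ell x X) = 0].

(* I is the p-interacting Fock space (H, p); its creators are the maps
   [p \o ell x] on I. *)
Definition interacting_fock I p := pre_fock I /\ squeezing I p.

Definition id_on_H p := forall x : H, p (word F [:: x]) = word F [:: x].

(* T restricts to the bounded operator A (x) B on [ctpow (m + n)], for
   operators A on [ctpow m] and B on [ctpow n]. *)
Definition tensor_operator (m n : nat) (A B T : F -> F) :=
  [/\ linear T, continuous T
    & forall X Y, ctpow m X -> ctpow n Y -> T (tens X Y) = tens (A X) (B Y)].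

Definition operator_le V (A B : F -> F) :=
  forall X, V X -> ip F (A X) X <= ip F (B X) X.

(* pi_(n+1) <= id_H (x) pi_n for all n *)
Definition left_decreasing P :=
  forall n, exists2 T, tensor_operator 1 n id P T
                     & operator_le (ctpow (1 + n)) P T.

(* pi_(n+1) <= pi_n (x) id_H for all n *)
Definition right_decreasing P :=
  forall n, exists2 T, tensor_operator n 1 P id T
                     & operator_le (ctpow (n + 1)) P T.

(* The standing assumptions of the two situations; in the first one, the
   squeezing p is only defined on [sqdom I] and P is its extension. *)
Definition projection_squeezing I p :=
  [/\ interacting_fock I p, weak_projection (sqdom I) p & id_on_H p].

Definition decreasing_fock_projection P :=
  [/\ linear P /\ continuous P, weak_projection afock P, fock_map afock P,
      id_on_H P & left_decreasing P].

Definition coisometry V W w :=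
  [/\ linear_on V w, forall x, V x -> W (w x)
    & exists w' : F -> F,
      [/\ linear_on W w', forall y, W y -> V (w' y),
          forall x y, V x -> W y -> ip F (w x) y = ip F x (w' y)
        & forall y, W y -> w (w' y) = y]].

(* w m n (pi_m X_m (x) pi_n Y_n) = pi_(m+n) (X_m (x) Y_n) *)
Definition product_formula P (w : nat -> nat -> F -> F) :=
  forall m n X Y, tpow m X -> tpow n Y ->
    w m n (tens (P X) (P Y)) = P (tens X Y).

Definition coisometric_products P (w : nat -> nat -> F -> F) :=
  (forall m n, coisometry (atens (P @` tpow m) (P @` tpow n))
                          (P @` tpow (m + n)) (w m n))
  /\ product_formula P w.

Definition completed_coisometric_products P (w : nat -> nat -> F -> F) :=
  (forall m n, coisometry (closure (atens (P @` tpow m) (P @` tpow n)))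
                          (closure (P @` tpow (m + n))) (w m n))
  /\ product_formula P w.

(* A subproduct system whose n-th member is a closed subspace of [ctpow n],
   so that the Hilbert space tensor product of K m and K n is the closure of
   [atens (K m) (K n)]. *)
Definition subproduct_system (K : nat -> set F) (v : nat -> nat -> F -> F) :=
  [/\ forall n, [/\ lsubspace (K n), closed (K n) & K n `<=` ctpow n],
      K 0%N = lspan [set vac],
      forall m n, coisometry (closure (atens (K m) (K n))) (K (m + n)%N)
                             (v m n),
      forall l m n x y z, K l x -> K m y -> K n z ->
        v (l + m)%N n (tens (v l m (tens x y)) z)
        = v l (m + n)%N (tens x (v m n (tens y z)))
    & forall n x, K n x -> v 0%N n (tens vac x) = x
                           /\ v n 0%N (tens x vac) = x].

(* span a^*(S)^n Omega for the creators a^*(x) X_n = v 1 n (x (x) X_n), x in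
   S. *)
Fixpoint created (v : nat -> nat -> F -> F) (S : set F) (n : nat) : set F :=
  if n is n'.+1 then
    lspan [set v 1%N n' (tens x X) | x in S & X in created v S n']
  else lspan [set vac].

(* I is the interacting Fock space of a subproduct system with product v,
   built with the creators a^*(x) for x in S; for the subproduct system K,
   S is K 1. *)
Definition associated_fock (v : nat -> nat -> F -> F) (S I : set F)
    (a : F -> F -> F) :=
  I = lspan (\bigcup_n created v S n)
  /\ forall n x X, S x -> created v S n X -> a x X = v 1%N n (tens x X).

End InteractingFock.

Arguments tpow {R H} F n _.
Arguments ctpow {R H} F n _.
Arguments afock {R H} F _.

(* Main.v *)
(* Every operator involved is an orthogonal projection, so that order relations
   become identities between projections: for orthogonal projections A, B, P
   the inequality P <= A (x) B just says P(X (x) Y) = P(AX (x) BY), since P <= T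
   means that P vanishes on ker T.  In this form the squeezing condition, which
   kills H (x) I^perp, is P(x (x) Y) = P(x (x) PY), that is (i).  With the
   right-hand version of (i) one gets P(X (x) Y) = P(PX (x) PY), so the desired
   product is P itself, restricted to tensors of the summands, and its adjoint
   is the inclusion.  Conversely a coisometry w with the product formula is a
   contraction sending (P (x) P)Z to PZ, so P vanishes on ker (P (x) P). *)
Require Import Defs.
From HB Require Import structures.
From mathcomp Require Import all_boot all_order all_algebra.
From mathcomp Require Import complex.
From mathcomp Require Import all_classical all_reals all_analysis.
From mathcomp Require Import ring.

Import Order.TTheory GRing.Theory Num.Theory Num.Def.
Import numFieldNormedType.Exports.

Local Open Scope classical_set_scope.
Local Open Scope ring_scope.

(** The obstacle in (a) is that [p] lives only on [sqdom I], a domain that depends on [I]. Its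
    extension [P] must be shown to preserve degrees everywhere and to map [afock F] onto [I]; this
    rests on the density of [sqdom I] and on the given grading of [I]. After that, both situations
    are instances of one record, [fock_projection].

    The tensor product of two projections is not built factorwise: it is the projection onto the
    closed span of the tensors of the two ranges. Since [tens] is given only by inner products,
    identities are checked on words and carried over by density.

    In (c) completion matters. The inclusion of the image of degree m + n into the tensor product of
    the images of degrees m and n, which serves as adjoint, follows from a norm argument and is
    obtained only for the completed tensor product. For algebraic tensor products it is a separate
    condition, which the existence of coisometries also forces. *)

(** * Subspaces, spans and maps linear on a subspace *)

Section LinearAlgebra.
Context {K : numFieldType} {V : lmodType K}.
Implicit Types (S A B : set V) (f g : V -> V).

Lemma lsubspaceD {S} : lsubspace S -> forall x y, S x -> S y -> S (x + y).
Proof. by move=> [_ h] x y Sx Sy; rewrite -[x]scale1r; exact: h. Qed.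

Lemma lsubspaceZ {S} : lsubspace S -> forall a x, S x -> S (a *: x).
Proof. by move=> [S0 h] a x Sx; rewrite -[_ *: _]addr0; exact: h. Qed.

Lemma lsubspaceB {S} : lsubspace S -> forall x y, S x -> S y -> S (x - y).
Proof.
by move=> [_ h] x y Sx Sy; rewrite addrC -scaleN1r; exact: h.
Qed.

Lemma lsubspaceT : lsubspace [set: V].
Proof. by []. Qed.

Lemma lspan_lsubspace A : lsubspace (lspan A).
Proof.
split=> [S [[S0 _] _] //|a x y Ax Ay S [sS AS]].
by apply: sS.2; [apply: Ax|apply: Ay].
Qed.

Lemma sub_lspan A : A `<=` lspan A.
Proof. by move=> x Ax S [_]; apply. Qed.

Lemma lspan_sub A S : lsubspace S -> A `<=` S -> lspan A `<=` S.
Proof. by move=> sS AS x; apply. Qed.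

Lemma lspan_mono {A B} : A `<=` B -> lspan A `<=` lspan B.
Proof.
by move=> AB; apply: lspan_sub (lspan_lsubspace _) _ => x /AB; exact: sub_lspan.
Qed.

Lemma linear_onD {S f} : linear_on S f ->
  forall x y, S x -> S y -> f (x + y) = f x + f y.
Proof. by move=> fl x y Sx Sy; rewrite -[x]scale1r fl // !scale1r. Qed.

Lemma linear_on0 {S f} : lsubspace S -> linear_on S f -> f 0 = 0.
Proof.
move=> [S0 _] fl; have := linear_onD fl _ _ S0 S0.
by rewrite addr0 => /eqP; rewrite addrC -subr_eq subrr => /eqP.
Qed.

Lemma linear_onB {S f} : linear_on S f ->
  forall x y, S x -> S y -> f (x - y) = f x - f y.
Proof.
move=> fl x y Sx Sy.
by rewrite -scaleN1r addrC fl // scaleN1r addrC.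
Qed.

Lemma linear_on_preim {S f A} : lsubspace S -> lsubspace A -> linear_on S f ->
  lsubspace [set x | S x /\ A (f x)].
Proof.
move=> sS sA fl; split=> [|a x y [Sx Ax] [Sy Ay]] /=.
  by rewrite (linear_on0 sS fl); split; [apply: sS.1|apply: sA.1].
by rewrite fl//; split; [apply: sS.2|apply: sA.2].
Qed.

Lemma linear_on_image {S f} : lsubspace S -> linear_on S f ->
  lsubspace (f @` S).
Proof.
move=> sS fl; split.
  by exists 0; [apply: sS.1|apply: linear_on0 sS fl].
move=> a _ _ [x Sx <-] [y Sy <-]; exists (a *: x + y); first exact: sS.2.
exact: fl.
Qed.

Lemma linear_on_lspan {A f} {B : set V} : linear_on (lspan A) f ->
  (forall x, A x -> B (f x)) -> lsubspace B -> forall x, lspan A x -> B (f x).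
Proof.
move=> fl AB sB x Ax.
have [//] : (lspan A x /\ B (f x)).
move: x Ax; apply: lspan_sub (linear_on_preim (lspan_lsubspace A) sB fl) _.
by move=> x Ax; split; [exact: sub_lspan|exact: AB].
Qed.

Lemma lspan_image {A f} : linear_on (lspan A) f -> f @` lspan A = lspan (f @` A).
Proof.
move=> fl; apply/seteqP; split.
  move=> _ [x Ax <-]; apply: (linear_on_lspan fl) (lspan_lsubspace _) x Ax.
  by move=> x Ax; apply: sub_lspan; exists x.
apply: lspan_sub; first exact: linear_on_image (lspan_lsubspace _) fl.
by move=> _ [x Ax <-]; exists x => //; exact: sub_lspan.
Qed.

End LinearAlgebra.

(** * Inner products, norms and closures *)

Section PreHilbertSpaces.
Context {R : realType} {V : preHilbert R}.
Implicit Types (x y z : V) (S A B C : set V) (a : R[i]).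

Lemma ipDl x y z : ip V (x + y) z = ip V x z + ip V y z.
Proof. exact: linearDl. Qed.
Lemma ipDr x y z : ip V x (y + z) = ip V x y + ip V x z.
Proof. exact: linearDr. Qed.
Lemma ipBl x y z : ip V (x - y) z = ip V x z - ip V y z.
Proof. exact: linearBl. Qed.
Lemma ipBr x y z : ip V x (y - z) = ip V x y - ip V x z.
Proof. exact: linearBr. Qed.
Lemma ipZl a x y : ip V (a *: x) y = a * ip V x y.
Proof. exact: linearZl_LR. Qed.
Lemma ipZr a x y : ip V x (a *: y) = a^* * ip V x y.
Proof. exact: linearZr_LR. Qed.
Lemma ip0l x : ip V 0 x = 0.
Proof. exact: linear0l. Qed.
Lemma ip0r x : ip V x 0 = 0.
Proof. exact: linear0r. Qed.
Lemma ipC x y : ip V x y = (ip V y x)^*.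
Proof. by rewrite hermC expr0 mul1r. Qed.
Lemma ipxx_ge0 x : 0 <= ip V x x.
Proof. exact: dnorm_ge0. Qed.
Lemma ipxx_eq0 x : ip V x x = 0 -> x = 0.
Proof. by move/eqP; rewrite dnorm_eq0 => /eqP. Qed.

Lemma ip_ext x y : (forall z, ip V x z = ip V y z) -> x = y.
Proof.
move=> xy; apply/eqP; rewrite -subr_eq0; apply/eqP/ipxx_eq0.
by rewrite ipBl xy subrr.
Qed.

Lemma ip_eq0C x y : ip V x y = 0 -> ip V y x = 0.
Proof. by rewrite ipC => /eqP; rewrite conjC_eq0 => /eqP. Qed.

Lemma normD_orth x y : ip V x y = 0 -> `|x + y| ^+ 2 = `|x| ^+ 2 + `|y| ^+ 2.
Proof.
move=> xy; rewrite !norm_ip ipDl !ipDr xy (ip_eq0C _ _ xy).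
by rewrite addr0 add0r.
Qed.

Lemma cauchy_schwarz x y : `|ip V x y| <= `|x| * `|y|.
Proof.
have [->|y0] := eqVneq y 0; first by rewrite ip0r !normr0 mulr0.
have y20 : 0 < ip V y y by rewrite dnorm_gt0.
pose c := ip V x y / ip V y y.
have xy : ip V (x - c *: y) (c *: y) = 0.
  by rewrite ipZr ipBl ipZl divfK ?subrr ?mulr0 // gt_eqF.
have h : `|c *: y| ^+ 2 <= `|x| ^+ 2.
  by rewrite -[in leRHS](subrK (c *: y) x) normD_orth // lerDr exprn_ge0.
rewrite -(@ler_pXn2r _ 2%N) ?nnegrE ?mulr_ge0 //.
rewrite exprMn (norm_ip y) -ler_pdivrMr //.
apply: le_trans h; rewrite normrZ exprMn norm_ip.
rewrite normf_div (ger0_norm (ltW y20)) exprMn exprVn.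
by rewrite -mulrA expr2 invfM divfK // gt_eqF.
Qed.

Lemma closureP A x :
  closure A x <-> forall e : R[i], 0 < e -> exists2 y, A y & `|x - y| < e.
Proof.
split=> [clA e e0|h B /nbhs_ballP[e /= e0 eB]].
  have [y [Ay]] := clA _ (nbhsx_ballx x e e0).
  by rewrite -ball_normE /=; exists y.
have [y Ay xy] := h _ e0; exists y; split => //; apply: eB.
by rewrite -ball_normE.
Qed.

Lemma closure_min A C : closed C -> A `<=` C -> closure A `<=` C.
Proof. by move=> cC AC x /(closureS AC); exact: cC. Qed.

Lemma small_eq0 (U : normedZmodType R[i]) (u : U) (k : R[i]) : 0 <= k ->
  (forall e : R[i], 0 < e -> `|u| <= k * e) -> u = 0.
Proof.
move=> k0 h; apply/eqP; rewrite -normr_le0; apply/negP => /negP u0.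
have {}u0 : 0 < `|u|.
  by rewrite normr_gt0; apply: contra u0 => /eqP ->; rewrite normr0.
have k1 : 0 < 2 * (k + 1) by rewrite mulr_gt0 // ltr_wpDl.
have := h (`|u| / (2 * (k + 1))) (divr_gt0 u0 k1).
rewrite mulrCA ler_pMr // ler_pdivlMr // mul1r lt_geF //.
by rewrite mulr_natl mulr2n ltr_wpDl ?addr_ge0 // ltrDl.
Qed.

End PreHilbertSpaces.

(** * Bounded linear maps on a subspace and extension by density *)

Section BoundedLinear.
Context {R : realType} {V : preHilbert R}.
Implicit Types (x y z : V) (A B C G : set V) (f g : V -> V).

Lemma closure_lsubspace {A} : lsubspace A -> lsubspace (closure A).
Proof.
move=> sA; split; first exact: subset_closure sA.1.
move=> a x y /closureP Ax /closureP Ay; apply/closureP => e e0.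
have a0 : 0 < `|a| + 1 by rewrite ltr_wpDl.
have [x' Ax' xx'] := Ax (e / 2 / (`|a| + 1)) ltac:(by rewrite !divr_gt0).
have [y' Ay' yy'] := Ay (e / 2) ltac:(by rewrite divr_gt0).
exists (a *: x' + y'); first exact: sA.2.
rewrite opprD addrACA -scalerBr (le_lt_trans (ler_normD _ _)) //.
rewrite [ltRHS](splitr e) ler_ltD // normrZ.
rewrite ltr_pdivlMr // in xx'; apply: le_trans (ltW xx').
by rewrite mulrC ler_wpM2l // lerDl.
Qed.

Lemma closed1 z : closed [set z].
Proof.
move=> x /closureP clx; apply/eqP; rewrite -subr_eq0; apply/eqP.
apply: (@small_eq0 _ _ _ 1) => // e e0.
by have [_ -> /ltW] := clx e e0; rewrite mul1r.
Qed.

Lemma lsubspace0 : lsubspace [set 0 : V].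
Proof. by split => // a _ _ -> ->; rewrite scaler0 addr0. Qed.

(** Both conditions are relative to [A] because a map such as [tens ^~ Y] is known to be linear and
    bounded only on a single degree. The norm bound is what carries statements from a subspace to
    its closure. *)
Definition bounded_linear A f :=
  linear_on A f /\ exists2 k, 0 <= k & forall x, A x -> `|f x| <= k * `|x|.

Lemma bounded_linear_id A : bounded_linear A id.
Proof. by split => //; exists 1 => // x _; rewrite mul1r. Qed.

Lemma bounded_linear_sub {A B f} : A `<=` B -> bounded_linear B f ->
  bounded_linear A f.
Proof.
move=> AB [fl [k k0 fk]]; split; first by move=> a x y /AB ? /AB; exact: fl.
by exists k => // x /AB; exact: fk.
Qed.

Lemma bounded_linear_comp {A} B {f g} : bounded_linear A f ->
  (forall x, A x -> B (f x)) -> bounded_linear B g ->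
  bounded_linear A (fun x => g (f x)).
Proof.
move=> [fl [k k0 fk]] AB [gl [l l0 gk]]; split.
  by move=> a x y Ax Ay /=; rewrite fl // gl//; exact: AB.
exists (l * k); first exact: mulr_ge0.
move=> x Ax /=; apply: le_trans (gk _ (AB _ Ax)) _.
by rewrite -mulrA ler_wpM2l // fk.
Qed.

Lemma bounded_linearB {A f g} : bounded_linear A f -> bounded_linear A g ->
  bounded_linear A (fun x => f x - g x).
Proof.
move=> [fl [k k0 fk]] [gl [l l0 gk]]; split.
  by move=> a x y Ax Ay /=; rewrite fl // gl// opprD addrACA scalerBr.
exists (k + l); first exact: addr_ge0.
move=> x Ax /=; apply: le_trans (ler_normB _ _) _.
by rewrite mulrDl lerD ?fk ?gk.
Qed.

Lemma bounded_linear_closure {A B f} : lsubspace A ->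
  bounded_linear (closure A) f -> closed B -> (forall x, A x -> B (f x)) ->
  forall x, closure A x -> B (f x).
Proof.
move=> sA [fl [k k0 fk]] cB AB x clx; apply: cB; apply/closureP => e e0.
have k1 : 0 < k + 1 by rewrite ltr_wpDl.
have [y Ay xy] := (closureP _ _).1 clx (e / (k + 1)) (divr_gt0 e0 k1).
have cly := subset_closure Ay.
exists (f y); first exact: AB.
rewrite -(linear_onB fl) //.
have := fk _ (lsubspaceB (closure_lsubspace sA) _ _ clx cly).
move/le_lt_trans; apply.
rewrite ltr_pdivlMr // in xy; apply: le_lt_trans xy.
by rewrite mulrC ler_wpM2l // lerDl.
Qed.

Lemma bounded_linear_closure_lspan {G B f} :
  bounded_linear (closure (lspan G)) f -> lsubspace B -> closed B ->
  (forall x, G x -> B (f x)) -> forall x, closure (lspan G) x -> B (f x).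
Proof.
move=> fb sB cB GB; apply: (bounded_linear_closure (lspan_lsubspace _) fb cB).
apply: linear_on_lspan GB sB.
exact: (bounded_linear_sub (@subset_closure _ _) fb).1.
Qed.

Lemma bounded_linear_ext {G f g} : bounded_linear (closure (lspan G)) f ->
  bounded_linear (closure (lspan G)) g -> (forall x, G x -> f x = g x) ->
  forall x, closure (lspan G) x -> f x = g x.
Proof.
move=> fb gb fg x clx; apply/eqP; rewrite -subr_eq0; apply/eqP.
apply: (bounded_linear_closure_lspan (bounded_linearB fb gb) lsubspace0
  (closed1 0)) clx => y Gy /=.
by rewrite fg // subrr.
Qed.

Lemma ip_closure_eq0 {A z} : (forall x, A x -> ip V x z = 0) ->
  forall x, closure A x -> ip V x z = 0.
Proof.
move=> h x /closureP clx; apply: (@small_eq0 _ _ _ `|z|) => // e e0.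
have [y Ay xy] := clx e e0.
rewrite -[ip _ _ _]subr0 -(h y Ay) -ipBl (le_trans (cauchy_schwarz _ _)) //.
by rewrite mulrC ler_wpM2l // ltW.
Qed.

Lemma ip_lspan_eq0 {G z} : (forall x, G x -> ip V x z = 0) ->
  forall x, lspan G x -> ip V x z = 0.
Proof.
move=> h; apply: lspan_sub h; split => [|a x y /= hx hy]; first exact: ip0l.
by rewrite ipDl ipZl hx hy mulr0 addr0.
Qed.

Lemma ip_span_eq0 {G z} : (forall x, G x -> ip V x z = 0) ->
  forall x, closure (lspan G) x -> ip V x z = 0.
Proof. by move=> h; apply: ip_closure_eq0; exact: ip_lspan_eq0. Qed.

End BoundedLinear.

(** * Nearest points and the projection theorem *)

Section ProjectionTheorem.
Context {R : realType} {V : preHilbert R}.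
Implicit Types (x y z c : V) (C : set V).

(** The order of [R[i]] is partial, so the infimum is taken in [R], over the real parts of the
    squared distances, and then embedded. *)
Lemma inf_dist_exists C x : C !=set0 -> exists D : R[i],
  (forall c, C c -> D <= `|x - c| ^+ 2) /\
  (forall e, 0 < e -> exists2 c, C c & `|x - c| ^+ 2 < D + e).
Proof.
move=> [c0 Cc0]; pose N y := complex.Re (ip V y y).
have NE y : `|y| ^+ 2 = (N y)%:C%C.
  by rewrite norm_ip /N RRe_real // ger0_real // ipxx_ge0.
pose S := [set N (x - c) | c in C].
have hS : has_inf S.
  split; first by exists (N (x - c0)), c0.
  by exists 0 => _ [c _ <-]; rewrite -lecR -NE exprn_ge0.
exists (inf S)%:C%C; split=> [c Cc|e e0].
  by rewrite NE lecR; apply: ge_inf; [exact: hS.2|exists c].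
have eE : e = (complex.Re e)%:C%C by rewrite RRe_real // ger0_real // ltW.
have e0' : 0 < complex.Re e by rewrite -ltcR -eE.
have [_ [c Cc <-] h] := inf_adherent e0' hS.
by exists c => //; rewrite NE eE -rmorphD ltcR.
Qed.

Lemma parallelogram x y :
  `|x + y| ^+ 2 + `|x - y| ^+ 2 = 2 * (`|x| ^+ 2 + `|y| ^+ 2).
Proof.
by rewrite !norm_ip !(ipBl, ipBr, ipDl, ipDr); ring.
Qed.

(** Let [t *: y] be the component of [x - c] along [y]. Moving from [c] to [c + t *: y] stays in [C]
    and lowers the squared distance by the square of the norm of [t *: y], which therefore cannot
    exceed the slack [e ^+ 2]. *)
Lemma near_minimizer_orth C x D c (e : R[i]) : lsubspace C ->
  (forall c, C c -> D <= `|x - c| ^+ 2) -> C c -> 0 < e ->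
  `|x - c| ^+ 2 < D + e ^+ 2 -> forall y, C y -> `|ip V (x - c) y| <= e * `|y|.
Proof.
move=> sC hD Cc e0 he y Cy.
have [->|y0] := eqVneq y 0; first by rewrite ip0r !normr0 mulr0.
have y20 : ip V y y != 0 by rewrite dnorm_eq0.
pose t := ip V (x - c) y / ip V y y.
have xy : ip V (x - c - t *: y) (t *: y) = 0.
  by rewrite ipZr ipBl ipZl divfK ?subrr ?mulr0.
have h : `|t *: y| <= e.
  rewrite -(@ler_pXn2r _ 2%N) ?nnegrE ?mulr_ge0 // ?(ltW e0)//.
  move: he; rewrite -[X in `|X| ^+ 2 < _](subrK (t *: y)) normD_orth // => he.
  rewrite -(lerD2l D); apply: le_trans (ltW he); rewrite lerD2r.
  by rewrite -addrA -opprD; apply: hD; apply: lsubspaceD => //; exact: lsubspaceZ.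
have -> : ip V (x - c) y = t * ip V y y by rewrite divfK.
rewrite -norm_ip normrM normrX normr_id expr2 mulrA -normrZ.
by rewrite ler_wpM2r.
Qed.

Lemma nearest_point C x : hilbert V -> lsubspace C -> closed C ->
  exists c, C c /\ forall y, C y -> ip V (x - c) y = 0.
Proof.
move=> hV sC cC; have [|D [hD De]] := inf_dist_exists C x.
  by exists 0; exact: sC.1.
(* Completeness is stated for filters, so the filter generated by the sets of near-minimizers takes
   the place of a minimizing sequence. *)
pose B (e : R[i]) := [set c | C c /\ `|x - c| ^+ 2 < D + e].
pose G := filter_from [set e : R[i] | 0 < e] B.
have GB e : 0 < e -> G (B e) by move=> e0; exists e.
have FG : ProperFilter G.
  apply: filter_from_proper; last first.
    by move=> e /De[c Cc ?]; exists c.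
  apply: filter_from_filter; first by exists 1 => /=.
  move=> i j i0 j0.
  have [ij|ji] := real_leP (gtr0_real i0) (gtr0_real j0).
    exists i => // c [Cc ci]; split; split => //.
    by apply: lt_le_trans ci _; rewrite lerD2l.
  exists j => // c [Cc cj]; split; split => //.
  by apply: lt_trans cj _; rewrite ltrD2l.
(* The midpoint of [c] and [c'] lies in [C], hence at squared distance at least [D] from [x]; the
   parallelogram law bounds what is left. With slack [e ^+ 2 / 4] this gives the Cauchy property at
   radius [e]. *)
have mid c c' e : B e c -> B e c' -> `|c - c'| ^+ 2 < 4 * e.
  move=> [Cc ce] [Cc' ce'].
  have := parallelogram (x - c') (x - c).
  have -> : x - c' - (x - c) = c - c' by rewrite opprB addrC subrKA.
  have -> : x - c' + (x - c) = 2 *: (x - 2^-1 *: (c + c')).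
    rewrite scalerBr scalerA divff ?pnatr_eq0 // scale1r addrACA -opprD.
    by rewrite scaler_nat mulr2n [c' + c]addrC.
  rewrite normrZ normr_nat exprMn -natrX => h.
  have : 4 * D <= 4 * `|x - 2^-1 *: (c + c')| ^+ 2.
    rewrite ler_pM2l // hD //; apply: lsubspaceZ => //; exact: lsubspaceD.
  move=> h4; rewrite -(ltrD2l (4 * D)).
  apply: le_lt_trans (_ : _ <= 2 * (`|x - c'| ^+ 2 + `|x - c| ^+ 2)) _.
    by rewrite -h lerD2r.
  apply: lt_le_trans (_ : _ < 2 * (D + e + (D + e))) _.
    by rewrite ltr_pM2l // ltrD.
  by rewrite le_eqVlt; apply/orP; left; apply/eqP; ring.
have /cvg_ex[c Gc] : cvg G.
  apply: hV; apply: cauchy_exP => e e0.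
  have e4 : 0 < e ^+ 2 / 4 by rewrite divr_gt0 ?exprn_gt0.
  have [z Cz zD] := De _ e4.
  exists z; exists (e ^+ 2 / 4) => // c Bc.
  rewrite -ball_normE /=.
  rewrite -(@ltr_pXn2r _ 2%N) ?nnegrE // ?(ltW e0)//.
  by rewrite [ltRHS](_ : _ = 4 * (e ^+ 2 / 4)); [exact: mid|field].
(* The limit [c] is approximated by [c'] that is also a near-minimizer. Splitting [x - c] at [c']
   then makes each half contribute at most [e] times the norm of [y]. *)
have near e : 0 < e -> exists c', [/\ C c', `|c - c'| < e &
    `|x - c'| ^+ 2 < D + e ^+ 2].
  move=> e0; have e2 : 0 < e ^+ 2 by rewrite exprn_gt0.
  have [c' [[Cc' h1] h2]] := filter_ex (filterI (GB _ e2) (Gc _ (nbhsx_ballx c e e0))).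
  by exists c'; split => //; rewrite -ball_normE in h2.
exists c; split.
  apply: cC; apply/closureP => e e0.
  by have [c' [? ? _]] := near e e0; exists c'.
move=> y Cy; apply: (@small_eq0 _ _ _ (2 * `|y|)); first by rewrite mulr_ge0.
move=> e e0; have [c' [Cc' cc' h]] := near e e0.
have -> : x - c = (x - c') - (c - c') by rewrite opprB addrA subrK.
rewrite ipBl (le_trans (ler_normB _ _)) //.
rewrite -mulrA mulr_natl mulr2n lerD //.
  by rewrite mulrC (near_minimizer_orth C x D).
by rewrite (le_trans (cauchy_schwarz _ _)) // mulrC ler_wpM2l // ltW.
Qed.

Lemma projection_theorem C : hilbert V -> lsubspace C -> closed C ->
  exists P : V -> V, (forall x, C (P x)) /\
    forall x y, C y -> ip V (x - P x) y = 0.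
Proof.
move=> hV sC cC.
have /choice[P hP] : forall x, exists c, C c /\ forall y, C y -> ip V (x - c) y = 0.
  by move=> x; exact: nearest_point.
by exists P; split => [x|x y]; [exact: (hP x).1|exact: (hP x).2].
Qed.

End ProjectionTheorem.

(** * Tensors, degrees and words in the full Fock space *)

Section FullFockSpace.
Context {R : realType} {H : preHilbert R} {F : fockSpace H}.
Implicit Types (X Y Z : F) (A B C G : set F) (f g P Q T : F -> F).

Lemma words_ctpow {n} {s : seq H} : size s = n -> ctpow F n (word F s).
Proof. by move=> sn; apply: subset_closure; apply: sub_lspan; exists s. Qed.

Lemma ctpow_lsubspace n : lsubspace (ctpow F n).
Proof. exact: closure_lsubspace (lspan_lsubspace _). Qed.

Lemma ctpow_closed n : closed (ctpow F n).
Proof. exact: closed_closure. Qed.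

Lemma tpow_ctpow {n X} : tpow F n X -> ctpow F n X.
Proof. exact: subset_closure. Qed.

Lemma tpow_afock {n X} : tpow F n X -> afock F X.
Proof. by move: X; apply: lspan_mono => _ [s _ <-]; exists s. Qed.

Lemma closure_afock : closure (afock F) = setT.
Proof. exact: word_dense. Qed.

Lemma ctpow_ind {n f B} : bounded_linear (ctpow F n) f -> lsubspace B ->
  closed B -> (forall s, size s = n -> B (f (word F s))) ->
  forall X, ctpow F n X -> B (f X).
Proof.
move=> fb sB cB h; apply: (bounded_linear_closure_lspan fb sB cB).
by move=> _ [s /= sn <-]; exact: h.
Qed.

Lemma ctpow_ext {n f g} : bounded_linear (ctpow F n) f ->
  bounded_linear (ctpow F n) g ->
  (forall s, size s = n -> f (word F s) = g (word F s)) ->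
  forall X, ctpow F n X -> f X = g X.
Proof.
move=> fb gb h; apply: (bounded_linear_ext fb gb).
by move=> _ [s /= sn <-]; exact: h.
Qed.

Lemma fock_ext {f g} : bounded_linear setT f -> bounded_linear setT g ->
  (forall s, f (word F s) = g (word F s)) -> forall X, f X = g X.
Proof.
rewrite -closure_afock => fb gb h X.
apply: (bounded_linear_ext fb gb) => [_ [s _ <-] //|].
by rewrite -[closure _]/(closure (afock F)) closure_afock.
Qed.

Lemma ip_ctpow_neq {m n} X Y : m <> n -> ctpow F m X -> ctpow F n Y ->
  ip F X Y = 0.
Proof.
move=> mn mX nY; move: X mX; apply: ip_span_eq0 => _ [s /= sm <-].
apply: ip_eq0C; move: Y nY; apply: ip_span_eq0 => _ [t /= tn <-].
by rewrite ip_word sm tn; case: eqP => // nm; case: mn.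
Qed.

(** By [ip_tens] the defect of linearity is orthogonal to every [tens X Z]. It is itself a
    combination of such tensors, hence orthogonal to itself. The same argument gives linearity in
    the left factor and of [word] on single letters. *)
Lemma tens_linear {n X} : ctpow F n X -> linear (tens (f:=F) X).
Proof.
move=> nX a Y Y'; apply/eqP; rewrite -subr_eq0; apply/eqP.
set D := _ - _; suff h Z : ip F (tens X Z) D = 0.
  by apply: ipxx_eq0; rewrite [in X in ip F X _]/D ipBl ipDl ipZl !h mulr0 addr0 subr0.
apply: ip_eq0C; rewrite /D ipBl ipDl ipZl !(ip_tens _ _ nX nX) ipDl ipZl.
by ring.
Qed.

Lemma tens_linear_on n Y : linear_on (ctpow F n) (tens (f:=F) ^~ Y).
Proof.
move=> a X X' nX nX'; apply/eqP; rewrite -subr_eq0; apply/eqP.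
have nXX := (ctpow_lsubspace n).2 a _ _ nX nX'.
set D := _ - _; suff h Z : ctpow F n Z -> ip F (tens Z Y) D = 0.
  by apply: ipxx_eq0; rewrite [in X in ip F X _]/D ipBl ipDl ipZl !h // mulr0 addr0 subr0.
move=> nZ; apply: ip_eq0C; rewrite /D ipBl ipDl ipZl.
rewrite (ip_tens _ _ nXX nZ) (ip_tens _ _ nX nZ) (ip_tens _ _ nX' nZ) ipDl ipZl.
by ring.
Qed.

Lemma norm_tens {n X} Y : ctpow F n X -> `|tens X Y| = `|X| * `|Y|.
Proof.
move=> nX; apply/eqP; rewrite -(@eqrXn2 _ 2%N) ?mulr_ge0 //.
by rewrite exprMn !norm_ip (ip_tens _ _ nX nX).
Qed.

Lemma tens_bounded_linear {n X} A : ctpow F n X -> bounded_linear A (tens X).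
Proof.
move=> nX; split; first by move=> a Y Y' _ _; exact: (tens_linear nX).
by exists `|X| => // Y _; rewrite (norm_tens _ nX).
Qed.

Lemma tensl_bounded_linear n Y :
  bounded_linear (ctpow F n) (tens (f:=F) ^~ Y).
Proof.
split; first exact: tens_linear_on.
by exists `|Y| => // X nX; rewrite (norm_tens _ nX) mulrC.
Qed.

Lemma tensDr {n X} Y Y' : ctpow F n X -> tens X (Y + Y') = tens X Y + tens X Y'.
Proof. by move=> nX; exact: (linear_onD (tens_bounded_linear setT nX).1). Qed.

Lemma tensBr {n X} Y Y' : ctpow F n X -> tens X (Y - Y') = tens X Y - tens X Y'.
Proof. by move=> nX; exact: (linear_onB (tens_bounded_linear setT nX).1). Qed.

Lemma tens0r {n X} : ctpow F n X -> tens X 0 = 0.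
Proof. by move=> nX; exact: (linear_on0 lsubspaceT (tens_bounded_linear setT nX).1). Qed.

Lemma tens_ctpow {m n X Y} : ctpow F m X -> ctpow F n Y ->
  ctpow F (m + n) (tens X Y).
Proof.
move=> mX nY; move: X mX.
apply: (ctpow_ind (tensl_bounded_linear m Y) (ctpow_lsubspace _)
  (@ctpow_closed _)) => s sm.
move: Y nY.
apply: (ctpow_ind (tens_bounded_linear _ (words_ctpow sm)) (ctpow_lsubspace _)
  (@ctpow_closed _)) => t tn.
by rewrite tens_word; apply: words_ctpow; rewrite size_cat sm tn.
Qed.

Lemma tens_tpow {m n X Y} : tpow F m X -> tpow F n Y ->
  tpow F (m + n) (tens X Y).
Proof.
move=> mX nY; move: X mX.
apply: linear_on_lspan; last exact: lspan_lsubspace.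
  by move=> a X X' /tpow_ctpow mX /tpow_ctpow; apply: tens_linear_on.
move=> _ [s /= sm <-]; move: Y nY.
apply: linear_on_lspan; last exact: lspan_lsubspace.
  exact: (tens_bounded_linear _ (words_ctpow sm)).1.
move=> _ [t /= tn <-]; rewrite tens_word; apply: sub_lspan.
by exists (s ++ t) => //=; rewrite size_cat sm tn.
Qed.

Lemma vac_ctpow : ctpow F 0 (vac F).
Proof. exact: words_ctpow. Qed.

Lemma tens_vac X : tens (vac F) X = X.
Proof.
move: X; apply: (fock_ext (tens_bounded_linear _ vac_ctpow)).
  exact: bounded_linear_id.
by move=> s; rewrite tens_word.
Qed.

Lemma tens_vac_r {n X} : ctpow F n X -> tens X (vac F) = X.
Proof.
move: X; apply: (ctpow_ext (@tensl_bounded_linear n _)).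
  exact: bounded_linear_id.
by move=> s _; rewrite tens_word cats0.
Qed.

(** The three arguments are reduced to words one after the other, where this is associativity of
    concatenation. Only [Z] may be inhomogeneous. *)
Lemma tensA {l m X Y} Z : ctpow F l X -> ctpow F m Y ->
  tens (tens X Y) Z = tens X (tens Y Z).
Proof.
move=> lX mY; move: X lX; apply: (ctpow_ext
  (bounded_linear_comp (ctpow F (l + m)) (tensl_bounded_linear l Y)
     (fun X lX => tens_ctpow lX mY) (tensl_bounded_linear (l + m) Z))
  (tensl_bounded_linear l (tens Y Z))) => s sl.
have ls := words_ctpow sl; move: Y mY; apply: (ctpow_ext
  (bounded_linear_comp (ctpow F (l + m)) (tens_bounded_linear (ctpow F m) ls)
     (fun Y mY => tens_ctpow ls mY) (tensl_bounded_linear (l + m) Z))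
  (bounded_linear_comp setT (tensl_bounded_linear m Z)
     (fun _ _ => I) (tens_bounded_linear setT ls))) => t tm.
have mt := words_ctpow tm; move: Z; apply: (fock_ext
  (tens_bounded_linear setT (tens_ctpow ls mt))
  (bounded_linear_comp setT (tens_bounded_linear setT mt)
     (fun _ _ => I) (tens_bounded_linear setT ls))) => u.
by rewrite !tens_word catA.
Qed.

Lemma word_split {m n s} : size s = (m + n)%N -> exists s1 s2,
  [/\ size s1 = m, size s2 = n & word F s = tens (word F s1) (word F s2)].
Proof.
move=> sz; exists (take m s), (drop m s); split.
- by rewrite size_takel // sz leq_addr.
- by rewrite size_drop sz addKn.
- by rewrite tens_word cat_take_drop.
Qed.

Lemma tpow0 : tpow F 0 = lspan [set vac F].
Proof.
congr (lspan _); apply/seteqP; split=> [_ [s /= /size0nil -> <-] //|_ ->].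
by exists [::].
Qed.

(** The expansion of [X] along the unit vector [vac F] holds on the empty word, and both sides of it
    are bounded in [X]. *)
Lemma ctpow0 : ctpow F 0 = lspan [set vac F].
Proof.
apply/seteqP; split; last by rewrite -tpow0; exact: subset_closure.
move=> X X0; suff -> : X = ip F X (vac F) *: vac F.
  by apply: (lsubspaceZ (lspan_lsubspace _)); exact: sub_lspan.
move: X X0; apply: ctpow_ext; first exact: bounded_linear_id.
  split; first by move=> a X Y _ _; rewrite ipDl ipZl scalerDl scalerA.
  exists (`|vac F| * `|vac F|); first exact: mulr_ge0.
  move=> X _; rewrite normrZ mulrAC ler_wpM2r // mulrC.
  exact: cauchy_schwarz.
move=> s /size0nil ->; rewrite -/(vac F) /vac ip_word big_nil eqxx.
by rewrite scale1r.
Qed.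

Lemma word1_linear : forall (a : R[i]) (x y : H),
  word F [:: a *: x + y] = a *: word F [:: x] + word F [:: y].
Proof.
move=> a x y; apply/eqP; rewrite -subr_eq0; apply/eqP.
set D := _ - _; suff h z : ip F (word F [:: z]) D = 0.
  by apply: ipxx_eq0; rewrite [in X in ip F X _]/D ipBl ipDl ipZl !h mulr0 addr0 subr0.
apply: ip_eq0C; rewrite /D ipBl ipDl ipZl !ip_word /= !big_seq1 /= ipDl ipZl.
by rewrite subrr.
Qed.

Lemma tpow1P X : tpow F 1 X <-> exists x, X = word F [:: x].
Proof.
split=> [|[x ->]]; last by apply: sub_lspan; exists [:: x].
move: X; apply: lspan_sub.
  split=> [|a _ _ [x ->] [y ->]].
    exists 0; have := word1_linear (-1) 0 0.
    by rewrite !scaleN1r oppr0 addr0 addNr.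
  by exists (a *: x + y); rewrite word1_linear.
by move=> _ [[|x [|//]] //= _ <-]; exists x.
Qed.

(** The embedding of a letter [x] as [word F [:: x]] is isometric, so the letters whose words
    approach [X] generate a Cauchy filter in [H]. *)
Lemma ctpow1_complete : hilbert H -> ctpow F 1 = tpow F 1.
Proof.
move=> hH; apply/seteqP; split; last exact: subset_closure.
move=> X /closureP clX.
pose j (x : H) := word F [:: x].
have jB x y : j (x - y) = j x - j y.
  by rewrite /j -[x - y]addrC -scaleN1r word1_linear scaleN1r addrC.
have jn x : `|j x| = `|x|.
  apply/eqP; rewrite -(@eqrXn2 _ 2%N) // !norm_ip ip_word /= big_seq1 /=.
  exact: eqxx.
pose B (e : R[i]) := [set x : H | `|X - j x| < e].
pose G := filter_from [set e : R[i] | 0 < e] B.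
have GB e : 0 < e -> G (B e) by move=> e0; exists e.
have FG : ProperFilter G.
  apply: filter_from_proper; last first.
    by move=> e /clX[_ /tpow1P[x ->] ?]; exists x.
  apply: filter_from_filter; first by exists 1 => /=.
  move=> i k i0 k0.
  have [ik|ki] := real_leP (gtr0_real i0) (gtr0_real k0).
    exists i => // x xi; split => //; exact: lt_le_trans ik.
  exists k => // x xk; split => //; exact: lt_trans ki.
have /cvg_ex[x Gx] : cvg G.
  apply: hH; apply: cauchy_exP => e e0.
  have e2 : 0 < e / 2 by rewrite divr_gt0.
  have [_ /tpow1P[x ->] hx] := clX _ e2.
  exists x; exists (e / 2) => // y hy.
  rewrite -ball_normE /= -jn jB (splitr e).
  apply: le_lt_trans (ler_distD X _ _) _.
  by rewrite ltrD // distrC.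
apply/tpow1P; exists x; apply/eqP; rewrite -subr_eq0; apply/eqP.
apply: (@small_eq0 _ _ _ 2) => // e e0.
have [y [hy hxy]] := filter_ex (filterI (GB _ e0) (Gx _ (nbhsx_ballx x e e0))).
rewrite -ball_normE /= in hxy.
apply: le_trans (ler_distD (j y) _ _) _.
rewrite mulr_natl mulr2n lerD ?(ltW hy) //.
by rewrite -jB jn distrC ltW.
Qed.

End FullFockSpace.

(** * Orthogonal projections and their tensor products *)

Section OrthogonalProjections.
Context {R : realType} {H : preHilbert R} {F : fockSpace H}.
Implicit Types (X Y Z : F) (A B C G : set F) (f g P Q T : F -> F).

Lemma orthogonal_projection_id : orthogonal_projection (id : F -> F).
Proof. by split. Qed.

Section Theory.
Variables (P : F -> F) (opP : orthogonal_projection P).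

Lemma projB X Y : P (X - Y) = P X - P Y.
Proof.
have [lP _ _] := opP.
by rewrite addrC -scaleN1r lP scaleN1r addrC.
Qed.

Lemma projD X Y : P (X + Y) = P X + P Y.
Proof. by have [lP _ _] := opP; rewrite -[X]scale1r lP !scale1r. Qed.

Lemma proj_idem X : P (P X) = P X.
Proof. by have [_ ->] := opP. Qed.

Lemma proj_adj X Y : ip F (P X) Y = ip F X (P Y).
Proof. by have [_ _ ->] := opP. Qed.

Lemma ip_proj X : ip F (P X) X = `|P X| ^+ 2.
Proof. by rewrite norm_ip -proj_adj proj_idem. Qed.

Lemma proj_pythagoras X : `|X| ^+ 2 = `|P X| ^+ 2 + `|X - P X| ^+ 2.
Proof.
rewrite -normD_orth; first by rewrite addrC subrK.
by rewrite proj_adj projB proj_idem subrr ip0r.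
Qed.

Lemma norm_proj X : `|P X| <= `|X|.
Proof.
rewrite -(@ler_pXn2r _ 2%N) ?nnegrE // (proj_pythagoras X).
by rewrite lerDl exprn_ge0.
Qed.

Lemma norm_proj_fixed X : `|X| <= `|P X| -> P X = X.
Proof.
rewrite -(@ler_pXn2r _ 2%N) ?nnegrE // (proj_pythagoras X) gerDl => h.
have : `|X - P X| ^+ 2 == 0 by rewrite eq_le h exprn_ge0.
by rewrite expf_eq0 /= normr_eq0 subr_eq0 => /eqP.
Qed.

Lemma proj_bounded_linear A : bounded_linear A P.
Proof.
have [lP _ _] := opP; split; first by move=> a X Y _ _; rewrite lP.
by exists 1 => // X _; rewrite mul1r norm_proj.
Qed.

Lemma proj_continuous : continuous P.
Proof.
move=> X; apply/cvgrPdist_lt => e e0; near=> Y; rewrite -projB.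
apply: le_lt_trans (norm_proj _) _.
by near: Y; apply: cvgr_dist_lt.
Unshelve. all: by end_near. Qed.

Lemma proj_fixed_lsubspace : lsubspace [set X | P X = X].
Proof.
have [lP _ _] := opP; split=> [|a X Y /= PX PY]; last by rewrite lP PX PY.
by rewrite /= -[in LHS](subrr 0) projB subrr.
Qed.

Lemma proj_fixed_closed : closed [set X | P X = X].
Proof.
move=> X clX; apply/eqP; rewrite -subr_eq0; apply/eqP.
have sX := proj_fixed_lsubspace.
apply: (bounded_linear_closure sX (bounded_linearB
  (proj_bounded_linear _) (bounded_linear_id _)) (closed1 0)) clX => Y /= ->.
by rewrite subrr.
Qed.

Lemma proj_image_sub_closed C : closed C -> (forall X, C X -> C (P X)) ->
  closed (P @` C).
Proof.
move=> cC CP X clX; exists X.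
  by apply: cC; move: X clX; apply: closureS => _ [X CX <-]; exact: CP.
apply: proj_fixed_closed; move: X clX; apply: closureS => _ [X _ <-].
exact: proj_idem.
Qed.

Lemma proj_onto_eq C X Y : (forall Z, C (P Z)) -> (forall Z, C Z -> P Z = Z) ->
  C Y -> (forall Z, C Z -> ip F (X - Y) Z = 0) -> P X = Y.
Proof.
move=> PC CP CY XY; rewrite -(CP Y CY); apply/eqP; rewrite -subr_eq0 -projB.
by apply/eqP/ipxx_eq0; rewrite proj_adj proj_idem XY.
Qed.

End Theory.

(** The projection theorem provides values only. A value is the unique point of [C] whose difference
    from [X] is orthogonal to [C], and this uniqueness yields linearity and idempotence. *)
Lemma orthogonal_projection_exists C : lsubspace C -> closed C ->
  exists P : F -> F, [/\ orthogonal_projection P, forall X, C (P X)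
    & forall X, C X -> P X = X].
Proof.
move=> sC cC.
have [P [PC PO]] := projection_theorem C (@fsort_hilbert _ _ F) sC cC.
have uniq X Y : C Y -> (forall Z, C Z -> ip F (X - Y) Z = 0) -> P X = Y.
  move=> CY XY; apply/eqP; rewrite -subr_eq0; apply/eqP/ipxx_eq0.
  have CD : C (P X - Y) by exact: lsubspaceB.
  have -> : ip F (P X - Y) (P X - Y) =
      ip F (X - Y) (P X - Y) - ip F (X - P X) (P X - Y).
    by rewrite -ipBl; congr (ip F _ _); rewrite opprB [RHS]addrC subrKA.
  by rewrite XY // PO // subrr.
exists P; split=> //; last by move=> X CX; apply: uniq => // Z _; rewrite subrr ip0l.
split=> [a X Y|X|X Y].
- apply: uniq => [|Z CZ]; first exact: sC.2.
  by rewrite opprD addrACA -scalerBr ipDl ipZl !PO // mulr0 addr0.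
- by apply: uniq => // Z _; rewrite subrr ip0l.
- have h1 : ip F (X - P X) (P Y) = 0 by exact: PO.
  have h2 : ip F (P X) (Y - P Y) = 0 by apply: ip_eq0C; exact: PO.
  move/eqP: h1; rewrite ipBl subr_eq0 => /eqP ->.
  by move/eqP: h2; rewrite ipBr subr_eq0 => /eqP ->.
Qed.

Lemma closure_atens A B n X Y : A `<=` ctpow F n ->
  lsubspace A -> lsubspace B -> closure A X -> closure B Y ->
  closure (atens A B) (tens X Y).
Proof.
move=> An sA sB cX cY.
have clA : closure A `<=` ctpow F n by apply: closure_min An; exact: ctpow_closed.
move: X cX; apply: (bounded_linear_closure sA
  (bounded_linear_sub clA (tensl_bounded_linear n Y)) (@closed_closure _ _)) => X AX.
move: Y cY; apply: (bounded_linear_closure sB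
  (tens_bounded_linear (closure B) (An _ AX)) (@closed_closure _ _)) => Y BY.
by apply: subset_closure; apply: sub_lspan; exists X => //; exists Y.
Qed.

Lemma bounded_linear_image_closure A f : lsubspace A ->
  bounded_linear (closure A) f -> forall X, closure A X -> closure (f @` A) (f X).
Proof.
move=> sA fb; apply: (bounded_linear_closure sA fb (@closed_closure _ _)) => X AX.
by apply: subset_closure; exists X.
Qed.

Section TensorProjection.
Variables (A B : F -> F) (m n : nat).
Hypotheses (opA : orthogonal_projection A) (opB : orthogonal_projection B).
Hypothesis ctA : forall X, ctpow F m X -> ctpow F m (A X).

(** As [A] and [B] are self-adjoint and idempotent, [ip_tens] makes the difference of X (x) Y and AX
    (x) BY orthogonal to all tensors of the two ranges. The projection onto their closed span thus
    has the required values on tensors. *)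
Lemma tensor_projection_exists : exists T,
  [/\ orthogonal_projection T, tensor_operator m n A B T
    & forall Z, closure (atens (A @` tpow F m) (B @` tpow F n)) (T Z)].
Proof.
pose C := closure (atens (A @` tpow F m) (B @` tpow F n)).
have sC : lsubspace C by exact: closure_lsubspace (lspan_lsubspace _).
have [T [opT TC CT]] := orthogonal_projection_exists C sC (@closed_closure _ _).
have sAm : lsubspace (A @` tpow F m).
  exact: linear_on_image (lspan_lsubspace _) (proj_bounded_linear _ opA _).1.
have sBn : lsubspace (B @` tpow F n).
  exact: linear_on_image (lspan_lsubspace _) (proj_bounded_linear _ opB _).1.
have Am : A @` tpow F m `<=` ctpow F m.
  by move=> _ [X mX <-]; apply: ctA; exact: tpow_ctpow.
exists T; split=> //; split; [by case: opT|exact: proj_continuous|].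
move=> X Y mX nY; apply: (proj_onto_eq _ opT C) => //.
  apply: (closure_atens _ _ m) => //.
    by apply: (bounded_linear_image_closure _ _ (lspan_lsubspace _)) mX;
      exact: proj_bounded_linear.
  by apply: (bounded_linear_image_closure _ _ (lspan_lsubspace _)) nY;
    exact: proj_bounded_linear.
move=> Z CZ; apply: ip_eq0C; move: Z CZ; apply: ip_span_eq0.
move=> _ [_ [X' /tpow_ctpow mX' <-] [_ [Y' _ <-] <-]].
have mAX := ctA _ mX; have mAX' := ctA _ mX'.
rewrite ipBr !(ip_tens _ _ mAX') // !proj_adj // !proj_idem //.
by rewrite subrr.
Qed.

Lemma tensor_projection_absorbs P T : orthogonal_projection P ->
  orthogonal_projection T -> tensor_operator m n A B T ->
  (forall X Y, ctpow F m X -> ctpow F n Y ->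
     P (tens X Y) = P (tens (A X) (B Y))) ->
  forall Z, ctpow F (m + n) Z -> P Z = P (T Z).
Proof.
move=> opP opT [_ _ TE] PE.
apply: (ctpow_ext (proj_bounded_linear _ opP (ctpow F (m + n)))
  (bounded_linear_comp setT (proj_bounded_linear _ opT (ctpow F (m + n)))
     (fun _ _ => I) (proj_bounded_linear _ opP setT))) => s smn.
have [s1 [s2 [s1m s2n ->]]] := word_split (F := F) smn.
have c1 : ctpow F m (word F s1) by exact: words_ctpow.
have c2 : ctpow F n (word F s2) by exact: words_ctpow.
by rewrite (PE _ _ c1 c2) (TE _ _ c1 c2).
Qed.

Lemma operator_le_tensorP P : orthogonal_projection P ->
  (forall Y, ctpow F n Y -> ctpow F n (B Y)) ->
  (exists2 T, tensor_operator m n A B T & operator_le (ctpow F (m + n)) P T)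
  <-> (forall X Y, ctpow F m X -> ctpow F n Y ->
         P (tens X Y) = P (tens (A X) (B Y))).
Proof.
move=> opP ctB; split=> [[T [lT _ TE] PT] X Y mX nY|PE].
  have mAX := ctA _ mX; have nBY := ctB _ nY.
  (* This [T] is not assumed to be a projection; its values on tensors alone show that it kills [Z].
     Then |PZ|^2 = <PZ, Z> is bounded by <TZ, Z> = 0. *)
  apply/eqP; rewrite -subr_eq0 -projB //; set Z := _ - _.
  have /PT : ctpow F (m + n) Z.
    exact: (lsubspaceB (ctpow_lsubspace (m + n)) _ _
      (tens_ctpow mX nY) (tens_ctpow mAX nBY)).
  have -> : T Z = 0.
    have lT' : linear_on setT T by move=> a x y _ _; exact: lT.
    by rewrite (linear_onB lT') // !TE // !proj_idem // subrr.
  rewrite ip_proj // ip0l => h.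
  have : `|P Z| ^+ 2 == 0 by rewrite eq_le h exprn_ge0.
  by rewrite expf_eq0 /= normr_eq0.
have [T [opT TE _]] := tensor_projection_exists.
exists T => // Z mnZ; rewrite !ip_proj // ler_pXn2r ?nnegrE //.
by rewrite (tensor_projection_absorbs P T) // norm_proj.
Qed.

End TensorProjection.
End OrthogonalProjections.

(** * Fock projections and coisometries between their ranges *)

Section FockProjections.
Context {R : realType} {H : preHilbert R} {F : fockSpace H}.
Implicit Types (X Y Z : F) (A B C V W I : set F) (f g P Q T w : F -> F).

(** Common ground of both situations. The field [fp_tens] is inequality (i) as an identity, for all
    degrees of [Y] at once. *)
Record fock_projection P : Prop := FockProjection {
  fp_proj : orthogonal_projection P;
  fp_ctpow : forall n X, ctpow F n X -> ctpow F n (P X);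
  fp_vac : P (vac F) = vac F;
  fp_word1 : id_on_H P;
  fp_tens : forall x Y, ctpow F 1 x -> P (tens x Y) = P (tens x (P Y)) }.

(** The adjoint [w'] is isometric because [w] inverts it on the left, so Cauchy-Schwarz gives |wX|^2
    = <X, w'wX> <= |X| |wX|. *)
Lemma coisometry_contraction V W w : coisometry V W w ->
  forall X, V X -> `|w X| <= `|X|.
Proof.
move=> [_ VW [w' [_ WV adj ww']]] X VX.
have w'n Y : W Y -> `|w' Y| = `|Y|.
  move=> WY; apply/eqP; rewrite -(@eqrXn2 _ 2%N) // !norm_ip.
  by rewrite -adj ?ww' //; exact: WV.
have [->|wX0] := eqVneq (w X) 0; first by rewrite normr0.
have h : `|w X| ^+ 2 <= `|X| * `|w X|.
  have WwX := VW _ VX; rewrite norm_ip adj // -(w'n _ WwX).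
  apply: le_trans (cauchy_schwarz X (w' (w X))); rewrite -adj //.
  by rewrite ger0_norm // ipxx_ge0.
by rewrite expr2 ler_pM2r ?normr_gt0 in h.
Qed.

Lemma coisometry_lift V W w : coisometry V W w ->
  forall Y, W Y -> exists2 X, V X & w X = Y /\ `|X| = `|Y|.
Proof.
move=> [_ _ [w' [_ WV adj ww']]] Y WY; exists (w' Y); first exact: WV.
split; first exact: ww'.
apply/eqP; rewrite -(@eqrXn2 _ 2%N) // !norm_ip -adj ?ww' //; exact: WV.
Qed.

Lemma projection_coisometry P V W : orthogonal_projection P ->
  (forall X, V X -> W (P X)) -> W `<=` V -> (forall Y, W Y -> P Y = Y) ->
  coisometry V W P.
Proof.
move=> opP VW WV PW; split=> //; first by move=> a X Y _ _; case: opP => ->.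
exists id; split=> // X Y VX WY.
by rewrite proj_adj // PW.
Qed.

Section Theory.
Variables (P : F -> F) (fpP : fock_projection P).
Let opP : orthogonal_projection P := fp_proj P fpP.
Let ctP := fp_ctpow P fpP.

Lemma fp_ctpow0 X : ctpow F 0 X -> P X = X.
Proof.
rewrite ctpow0; move: X; apply: lspan_sub; first exact: (proj_fixed_lsubspace P opP).
by move=> _ ->; exact: fp_vac.
Qed.

Lemma fp_ctpow1 X : ctpow F 1 X -> P X = X.
Proof.
apply: (ctpow_ind (bounded_linear_id _) (proj_fixed_lsubspace _ opP)
  (proj_fixed_closed _ opP)).
by move=> [|x [|//]] //= _; exact: fp_word1.
Qed.

(** For a word the letters are peeled off from the left: [fp_tens] inserts [P] behind the first
    letter, the induction hypothesis acts under it, and [fp_tens] removes it again. *)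
Lemma fp_left_absorb m X Y : ctpow F m X -> P (tens X Y) = P (tens X (P Y)).
Proof.
move: X; apply: (ctpow_ext
  (bounded_linear_comp setT (tensl_bounded_linear m Y) (fun _ _ => I)
     (proj_bounded_linear _ opP setT))
  (bounded_linear_comp setT (tensl_bounded_linear m (P Y)) (fun _ _ => I)
     (proj_bounded_linear _ opP setT))) => s _.
elim: s => [|x s IH]; first by rewrite !tens_vac proj_idem.
have xE : word F (x :: s) = tens (word F [:: x]) (word F s).
  by rewrite tens_word.
have h1 := words_ctpow (F := F) (erefl (size [:: x])).
have h2 := words_ctpow (F := F) (erefl (size s)).
rewrite xE !(tensA _ h1 h2) fp_tens // IH -fp_tens //.
Qed.

(** The right factor is absorbed by [fp_left_absorb]. For the left factor, [Y] is taken to be a word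
    and its last letter is split off: the inequality in degree m + n inserts [P] before that letter,
    and induction on the length of the word acts under it. *)
Lemma right_decreasingP : right_decreasing P <-> forall m n X Y,
  ctpow F m X -> ctpow F n Y -> P (tens X Y) = P (tens (P X) (P Y)).
Proof.
have rdE n := operator_le_tensorP P id n 1 opP orthogonal_projection_id
  (@ctP n) P opP (fun _ h => h).
split=> [rd m n X Y mX nY|h n].
  rewrite (fp_left_absorb m) // [RHS](_ : _ = P (tens (P X) Y)); last first.
    by rewrite -(fp_left_absorb m) //; exact: ctP.
  rewrite -(fp_left_absorb m) //; move: Y nY.
  apply: (ctpow_ext
    (bounded_linear_comp setT (tens_bounded_linear (ctpow F n) mX)
       (fun _ _ => I) (proj_bounded_linear _ opP setT))
    (bounded_linear_comp setT (tens_bounded_linear (ctpow F n) (ctP _ _ mX))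
       (fun _ _ => I) (proj_bounded_linear _ opP setT))).
  elim: n => [s /size0nil ->|n IH s].
    by rewrite !(@tens_vac_r _ _ _ m) ?proj_idem //; exact: ctP.
  rewrite -addn1 => sn; have [s1 [s2 [s1n s21 ->]]] := word_split (F := F) sn.
  have n1 := words_ctpow (F := F) s1n; have h2 := words_ctpow (F := F) s21.
  have mPX := ctP _ _ mX.
  rewrite -(tensA _ mX n1) -(tensA _ mPX n1).
  have /rdE rd' := rd (m + n)%N.
  rewrite rd' //; last exact: tens_ctpow.
  rewrite [RHS]rd' //; last exact: tens_ctpow.
  by rewrite IH.
by apply/(rdE n) => X y nX y1; rewrite (h n 1%N _ _ nX y1) (fp_ctpow1 _ y1).
Qed.

Lemma fp_image_lsubspace A : lsubspace A -> lsubspace (P @` A).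
Proof. by move=> sA; exact: linear_on_image sA (proj_bounded_linear _ opP _).1. Qed.

Lemma fp_image_closed n : closed (P @` ctpow F n).
Proof.
by apply: proj_image_sub_closed => // [|X]; [exact: ctpow_closed|exact: ctP].
Qed.

Lemma fp_imageP n X : (P @` ctpow F n) X <-> ctpow F n X /\ P X = X.
Proof.
split=> [[Y nY <-]|[nX PX]]; last by exists X.
by split; [exact: ctP|exact: proj_idem].
Qed.

Lemma fp_tpow_image n : P @` tpow F n `<=` P @` ctpow F n.
Proof. by apply: image_subset; exact: subset_closure. Qed.

Lemma closure_fp_image n : closure (P @` tpow F n) = P @` ctpow F n.
Proof.
apply/seteqP; split; first exact: closure_min (fp_image_closed n) (@fp_tpow_image n).
move=> _ [X nX <-]; apply: (bounded_linear_image_closure _ P) nX.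
  exact: lspan_lsubspace.
exact: proj_bounded_linear.
Qed.

Lemma fp_tpow_ctpow n : P @` tpow F n `<=` ctpow F n.
Proof. by move=> X /fp_tpow_image /fp_imageP[]. Qed.

(** Connects the subproduct system, whose members are complete, with the products, which are given
    on the images of algebraic tensor powers. *)
Lemma closure_atens_image m n :
  closure (atens (P @` ctpow F m) (P @` ctpow F n)) =
  closure (atens (P @` tpow F m) (P @` tpow F n)).
Proof.
apply/seteqP; split; last first.
  apply: closureS; apply: lspan_mono => _ [X mX [Y nY <-]].
  by exists X; [exact: fp_tpow_image|exists Y => //; exact: fp_tpow_image].
apply: closure_min; first exact: closed_closure.
apply: lspan_sub; first exact: closure_lsubspace (lspan_lsubspace _).
move=> _ [X mX [Y nY <-]]; apply: (closure_atens _ _ m).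
- exact: fp_tpow_ctpow.
- exact: fp_image_lsubspace (lspan_lsubspace _).
- exact: fp_image_lsubspace (lspan_lsubspace _).
- by rewrite closure_fp_image.
- by rewrite closure_fp_image.
Qed.

Section Products.
Variables m n : nat.
Let G := atens (P @` tpow F m) (P @` tpow F n).

(* On algebraic tensors [P Z = w (T Z)] for the projection [T] extending
   [P (x) P], so [|P Z| <= |T Z|]; by density [P] vanishes on [ker T]. *)
Lemma contraction_product V w : G `<=` V -> linear_on V w ->
  (forall X, V X -> `|w X| <= `|X|) ->
  (forall X Y, tpow F m X -> tpow F n Y ->
     w (tens (P X) (P Y)) = P (tens X Y)) ->
  forall X Y, ctpow F m X -> ctpow F n Y ->
    P (tens X Y) = P (tens (P X) (P Y)).
Proof.
move=> GV lw wn wE X Y mX nY.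
have [T [opT [lT _ TE] _]] := tensor_projection_exists P P m n opP opP (@ctP m).
have lT' : linear_on setT T by move=> a x y _ _; exact: lT.
have GT : forall Z, tpow F (m + n) Z -> G (T Z) /\ w (T Z) = P Z.
  apply: lspan_sub.
    split=> [|a x y [Gx wx] [Gy wy]].
      have T0 := linear_on0 lsubspaceT lT'.
      have G0 : G 0 by apply: (lspan_lsubspace _).1.
      split; rewrite T0 //.
      have := linear_onB lw _ _ (GV _ G0) (GV _ G0); rewrite !subrr => ->.
      by rewrite -(subrr (0 : F)) projB // !subrr.
    split; first by rewrite lT; exact: (lspan_lsubspace _).2.
    have [lP _ _] := opP.
    by rewrite lT lP lw ?wx ?wy //; exact: GV.
  move=> _ [s /= smn <-].
  have [s1 [s2 [s1m s2n ->]]] := word_split (F := F) smn.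
  have t1 : tpow F m (word F s1) by apply: sub_lspan; exists s1.
  have t2 : tpow F n (word F s2) by apply: sub_lspan; exists s2.
  rewrite TE; [|exact: tpow_ctpow|exact: tpow_ctpow].
  split; last exact: wE.
  by apply: sub_lspan; exists (P (word F s1)); [exists (word F s1)|
    exists (P (word F s2)) => //; exists (word F s2)].
apply/eqP; rewrite -subr_eq0 -projB //; set u := _ - _; apply/eqP.
have mPX := ctP _ _ mX; have nPY := ctP _ _ nY.
have mnu : ctpow F (m + n) u.
  exact: (lsubspaceB (ctpow_lsubspace (m + n)) _ _
    (tens_ctpow mX nY) (tens_ctpow mPX nPY)).
have Tu : T u = 0 by rewrite (linear_onB lT') // !TE // !proj_idem // subrr.
apply: (@small_eq0 _ _ _ 2) => // e e0.
have [u' mnu' uu'] := (closureP _ _).1 mnu e e0.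
have [GTu wTu] := GT _ mnu'.
rewrite -[P u](subrK (P u')) -projB // -wTu.
rewrite (le_trans (ler_normD _ _)) // mulr_natl mulr2n lerD //.
  by rewrite (le_trans (norm_proj _ opP _)) // ltW.
rewrite (le_trans (wn _ (GV _ GTu))) //.
rewrite -[T u']subr0 -Tu -projB // (le_trans (norm_proj _ opT _)) //.
by rewrite distrC ltW.
Qed.

(** The product formula prescribes [w] at PX (x) PY as P(X (x) Y), which by [contraction_product] is
    the value of [P] at the same tensor. The product is therefore unique. *)
Lemma product_eq_proj V w : G `<=` V -> linear_on V w ->
  (forall X, V X -> `|w X| <= `|X|) ->
  (forall X Y, tpow F m X -> tpow F n Y ->
     w (tens (P X) (P Y)) = P (tens X Y)) ->
  forall X, G X -> w X = P X.
Proof.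
move=> GV lw wn wE X GX; have PE := contraction_product _ _ GV lw wn wE.
have lG : linear_on G (fun X => w X - P X).
  move=> a x y Gx Gy; have [lP _ _] := opP; rewrite lw; [|exact: GV|exact: GV].
  by rewrite lP opprD addrACA scalerBr.
apply/eqP; rewrite -subr_eq0; apply/eqP.
apply: (linear_on_lspan (B := [set 0]) lG) GX; last exact: lsubspace0.
move=> _ [_ [x mx <-] [_ [y ny <-] <-]] /=.
by rewrite wE // -PE ?subrr //; exact: tpow_ctpow.
Qed.

Hypothesis PE : forall X Y, ctpow F m X -> ctpow F n Y ->
  P (tens X Y) = P (tens (P X) (P Y)).

Lemma fp_atens X : G X -> (P @` tpow F (m + n)) (P X).
Proof.
move: X; apply: linear_on_lspan.
- exact: (proj_bounded_linear _ opP _).1.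
- move=> _ [_ [X mX <-] [_ [Y nY <-] <-]]; exists (tens X Y); first exact: tens_tpow.
  by rewrite PE //; exact: tpow_ctpow.
- exact: fp_image_lsubspace (lspan_lsubspace _).
Qed.

(** With [T] extending P (x) P one has P = PT in degree m + n, so |PZ| = |PTPZ| <= |TPZ|. A
    projection that does not shorten a vector fixes it; hence PZ lies in the range of [T]. *)
Lemma fp_tpow_atens : P @` tpow F (m + n) `<=` closure G.
Proof.
have [T [opT TE TG]] := tensor_projection_exists P P m n opP opP (@ctP m).
move=> _ [Z mnZ <-].
have mnPZ : ctpow F (m + n) (P Z) by apply: ctP; exact: tpow_ctpow.
suff <- : T (P Z) = P Z by exact: TG.
apply: norm_proj_fixed => //; rewrite -[in leLHS](proj_idem P opP).
by rewrite (tensor_projection_absorbs P P m n P T) // norm_proj.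
Qed.

Lemma completed_coisometry :
  coisometry (closure G) (closure (P @` tpow F (m + n))) P.
Proof.
apply: projection_coisometry => //.
- move=> X GX; apply: (bounded_linear_closure (lspan_lsubspace _)
    (proj_bounded_linear _ opP _) (@closed_closure _ _)) GX => Y GY.
  by apply: subset_closure; exact: fp_atens.
- by apply: closure_min fp_tpow_atens; exact: closed_closure.
- by rewrite closure_fp_image => Y /fp_imageP[].
Qed.

(** The hypothesis sharpens [fp_tpow_atens] from the closure of [G] to [G], so that the inclusion
    can act as adjoint without completion. *)
Lemma algebraic_coisometry : P @` tpow F (m + n) `<=` G ->
  coisometry G (P @` tpow F (m + n)) P.
Proof.
move=> PG; apply: projection_coisometry => //; first exact: fp_atens.
by move=> _ [Y _ <-]; exact: proj_idem.
Qed.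

End Products.
End Theory.
End FockProjections.

(** * Interacting Fock spaces and their projections *)

Section InteractingFockSpaces.
Context {R : realType} {H : preHilbert R} {F : fockSpace H}.
Implicit Types (X Y Z : F) (A B C V W I : set F) (p f g P Q T w : F -> F).

Lemma orth_lsubspace A : lsubspace (orth (F:=F) A).
Proof.
split=> [y _|a x y hx hy z Az]; first exact: ip0l.
by rewrite ipDl ipZl hx // hy // mulr0 addr0.
Qed.

Lemma ip_eq0_closed Y : closed [set X : F | ip F X Y = 0].
Proof. exact: ip_closure_eq0. Qed.

Lemma word1_ctpow (x : H) : ctpow F 1 (word F [:: x]).
Proof. exact: words_ctpow. Qed.

Lemma word_cons (x : H) s : word F (x :: s) = tens (word F [:: x]) (word F s).
Proof. by rewrite tens_word. Qed.

(** The inequality comes degree by degree, while [Y] is arbitrary on the right; this is harmless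
    because every word has a degree and words span a dense subspace. *)
Lemma left_decreasingP P : orthogonal_projection P ->
  (forall n X, ctpow F n X -> ctpow F n (P X)) ->
  left_decreasing P <->
  forall x Y, ctpow F 1 x -> P (tens x Y) = P (tens x (P Y)).
Proof.
move=> opP ctP.
have ldE n := operator_le_tensorP id P 1 n orthogonal_projection_id opP
  (fun _ h => h) P opP (@ctP n).
split=> [ld x Y x1|h n]; last by apply/(ldE n) => x Y x1 _; exact: h.
move: Y; apply: (fock_ext
  (bounded_linear_comp setT (tens_bounded_linear setT x1) (fun _ _ => I)
     (proj_bounded_linear _ opP setT))
  (bounded_linear_comp setT (proj_bounded_linear _ opP setT) (fun _ _ => I)
     (bounded_linear_comp setT (tens_bounded_linear setT x1) (fun _ _ => I)
        (proj_bounded_linear _ opP setT)))) => s.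
exact: ((ldE (size s)).1 (ld (size s)) _ _ x1 (words_ctpow (erefl _))).
Qed.

Lemma fp_image_afock P : fock_projection P ->
  P @` afock F = lspan (\bigcup_n P @` tpow F n).
Proof.
move=> fpP; have opP := fp_proj _ fpP; apply/seteqP; split.
  rewrite lspan_image; last exact: (proj_bounded_linear _ opP _).1.
  apply: lspan_mono => _ [_ [s _ <-] <-]; exists (size s) => //.
  by exists (word F s) => //; apply: sub_lspan; exists s.
apply: lspan_sub; first exact: fp_image_lsubspace (lspan_lsubspace _).
by move=> _ [n _ [X nX <-]]; exists X => //; exact: tpow_afock nX.
Qed.

Section SqueezingExtension.
Variables (I : set F) (p P : F -> F).
Hypotheses (sqI : projection_squeezing I p)
  (extP : projection_extension (sqdom I) p P).

Let opP : orthogonal_projection P := extP.1.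

Let pE X : sqdom I X -> p X = P X.
Proof. by move=> VX; rewrite extP.2. Qed.

Let imI X : I X <-> exists2 Z, sqdom I Z & P Z = X.
Proof.
have [[_ [_ _ pI _]] _ _] := sqI.
rewrite -{1}pI; split=> [[Z VZ <-]|[Z VZ <-]]; exists Z => //.
  by rewrite pE.
exact: pE.
Qed.

Let sI : lsubspace I.
Proof.
by have [[[Hn [_ _ _ ->]] _] _ _] := sqI; exact: lspan_lsubspace.
Qed.

Let vac_sqdom : sqdom I (vac F).
Proof. by apply: sub_lspan; right. Qed.

Let P_vac : P (vac F) = vac F.
Proof. by have [[_ [_ [pv _] _ _]] _ _] := sqI; rewrite -pE. Qed.

Let vac_I : I (vac F).
Proof. by apply/imI; exists (vac F). Qed.

Let fixI X : I X -> P X = X.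
Proof. by move=> /imI[Z _ <-]; exact: proj_idem. Qed.

Let ell_sqdom x Y Z : I Y -> orth I Z -> sqdom I (tens (word F [:: x]) (Y + Z)).
Proof.
move=> IY OZ; apply: sub_lspan; left.
by exists x => //; exists (Y + Z) => //; exists Y => //; exists Z.
Qed.

Let ell_I_sqdom x Y : I Y -> sqdom I (tens (word F [:: x]) Y).
Proof.
move=> IY; rewrite -[Y]addr0; apply: ell_sqdom => //.
exact: (orth_lsubspace _).1.
Qed.

Let ell_orth_sqdom x Z : orth I Z -> sqdom I (tens (word F [:: x]) Z).
Proof.
by move=> IZ; rewrite -[Z]add0r; apply: ell_sqdom => //; exact: sI.1.
Qed.

Let P_ell_orth x Z : orth I Z -> P (tens (word F [:: x]) Z) = 0.
Proof.
have [[_ [_ _ _ p0]] _ _] := sqI.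
by move=> OZ; rewrite -pE ?(p0 x Z) //; exact: ell_orth_sqdom.
Qed.

(** [P] fixes [I] and is self-adjoint, so [Y - P Y] is orthogonal to [I]; the squeezing kills its
    tensor with a letter. *)
Let P_tens x Y : ctpow F 1 x -> P (tens x Y) = P (tens x (P Y)).
Proof.
move: x; apply: (ctpow_ext
  (bounded_linear_comp setT (tensl_bounded_linear 1 Y) (fun _ _ => Logic.I)
     (proj_bounded_linear _ opP setT))
  (bounded_linear_comp setT (tensl_bounded_linear 1 (P Y)) (fun _ _ => Logic.I)
     (proj_bounded_linear _ opP setT))) => -[|x [|//]] //= _.
apply/eqP; rewrite -subr_eq0 -projB // -(tensBr _ _ (word1_ctpow x)).
rewrite P_ell_orth // => Z IZ.
by rewrite -(fixI _ IZ) -proj_adj // projB // proj_idem // subrr ip0l.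
Qed.

(** A word x (x) s is split along the projection [Q] onto the closure of [I]: the part with s - Qs
    lies in [sqdom I], the part with Qs is a limit of x (x) Y with Y in [I]. [P] cannot replace [Q]
    here, since [P_closure] is derived from this density. *)
Let sqdom_dense : closure (sqdom I) = setT.
Proof.
have [Q [opQ QI IQ]] :=
  orthogonal_projection_exists (closure I) (closure_lsubspace sI) (@closed_closure _ I).
have sV : lsubspace (closure (sqdom I)).
  exact: closure_lsubspace (lspan_lsubspace _).
apply/seteqP; split=> // X _; have : closure (afock F) X by rewrite closure_afock.
move: X; apply: closure_min; first exact: closed_closure.
apply: lspan_sub => // _ [s _ <-].
case: s => [|x s]; first exact: subset_closure.
rewrite word_cons -[word F s](subrK (Q (word F s))) (tensDr _ _ (word1_ctpow x)).
apply: (lsubspaceD sV).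
  apply: subset_closure; apply: ell_orth_sqdom => Z IZ.
  rewrite -(IQ Z (subset_closure IZ)) -proj_adj // projB // proj_idem //.
  by rewrite subrr ip0l.
move: (Q (word F s)) (QI (word F s)).
apply: (bounded_linear_closure sI (tens_bounded_linear (closure I) (word1_ctpow x))).
  exact: closed_closure.
by move=> Y IY; apply: subset_closure; exact: ell_I_sqdom.
Qed.

Let P_closure X : closure I (P X).
Proof.
have : closure (sqdom I) X by rewrite sqdom_dense.
move: X; apply: (bounded_linear_closure (lspan_lsubspace _)
  (proj_bounded_linear _ opP _) (@closed_closure _ _)) => X VX.
by apply: subset_closure; apply/imI; exists X.
Qed.

(** The squeezing preserves degree only on its domain, so the grading of [I] is used. With [Q] the
    projection onto degree n, PX - QPX is orthogonal to each component of [I]: in degree n by the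
    choice of [Q], in another degree because [P] is self-adjoint and fixes [I]. As PX lies in the
    closure of [I], this difference is orthogonal to itself. *)
Let P_ctpow n X : ctpow F n X -> ctpow F n (P X).
Proof.
move=> nX; have [[[Hn [_ Hc _ IE]] _] _ _] := sqI.
have [Q [opQ Qn nQ]] :=
  orthogonal_projection_exists (ctpow F n) (ctpow_lsubspace n) (ctpow_closed n).
have /ip_eq0C ZP : ip F (P X) (P X - Q (P X)) = 0.
  have := P_closure X; apply: ip_closure_eq0 => Y IY.
  have PY := fixI _ IY; move: Y IY PY; rewrite IE.
  suff h : forall Y, lspan (\bigcup_k Hn k) Y -> ip F Y (P X - Q (P X)) = 0.
    by move=> Y hY _; exact: h.
  apply: ip_lspan_eq0 => Y [k _ HkY]; have kY := Hc _ _ HkY.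
  have PY : P Y = Y.
    by apply: fixI; rewrite IE; apply: sub_lspan; exists k.
  apply: ip_eq0C; rewrite ipBl; have [kn|/nesym kn] := pselect (k = n).
    by rewrite (proj_adj Q opQ) (nQ Y) ?subrr // -kn.
  by rewrite (proj_adj P opP) PY !(ip_ctpow_neq _ _ kn) // subrr.
have ZQ : ip F (P X - Q (P X)) (Q (P X)) = 0.
  by rewrite -proj_adj // projB // proj_idem // subrr ip0l.
suff -> : P X = Q (P X) by [].
apply/eqP; rewrite -subr_eq0; apply/eqP/ipxx_eq0.
by rewrite ipBr ZP ZQ subrr.
Qed.

Let P_word1 : id_on_H P.
Proof.
have [_ _ pH] := sqI; move=> x; rewrite -pE; first exact: pH.
by rewrite -(tens_vac_r (word1_ctpow x)); exact: ell_I_sqdom.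
Qed.

Lemma squeezing_fock_projection : fock_projection P.
Proof. by split. Qed.

Let image_sub_I X : afock F X -> I (P X).
Proof.
move: X; apply: linear_on_lspan sI; first exact: (proj_bounded_linear _ opP _).1.
move=> _ [s _ <-]; elim: s => [|x s IH]; first by rewrite -/(vac F) P_vac.
rewrite word_cons (P_tens _ _ (word1_ctpow x)); apply/imI.
by exists (tens (word F [:: x]) (P (word F s))) => //; exact: ell_I_sqdom.
Qed.

(* The homogeneous components of [I] lie in [P] of the algebraic tensor
   powers: apply the projection [Q] onto degree [n + 1] to
   [P (x (x) Y)] with [Y] in [I]. *)
Let component_I n Q : orthogonal_projection Q -> (forall X, ctpow F n (Q X)) ->
  (forall X, ctpow F n X -> Q X = X) ->
  forall Y, I Y -> (P @` tpow F n) (Q Y).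
Proof.
have fpP := squeezing_fock_projection.
elim: n Q => [|n IH] Q opQ Qn nQ Y IY.
  exists (Q Y); last exact: fp_ctpow0.
  by have := Qn Y; rewrite ctpow0 tpow0.
have [Q' [opQ' Q'n nQ']] :=
  orthogonal_projection_exists (ctpow F n) (ctpow_lsubspace n) (ctpow_closed n).
have sPn : lsubspace (P @` tpow F n.+1).
  exact: fp_image_lsubspace (lspan_lsubspace _).
have [Z VZ <-] := (imI Y).1 IY.
move: Z VZ; apply: (linear_on_lspan (f := fun Z => Q (P Z))) sPn.
  exact: (bounded_linear_comp setT (proj_bounded_linear _ opP _)
    (fun _ _ => Logic.I) (proj_bounded_linear _ opQ _)).1.
move=> v [|->]; last first.
  rewrite P_vac (proj_onto_eq _ opQ _ _ 0 Qn nQ) //.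
  - by apply: (fp_image_lsubspace _ fpP _ (lspan_lsubspace _)).1.
  - exact: (ctpow_lsubspace _).1.
  - by move=> Z nZ; rewrite subr0; apply: ip_ctpow_neq nZ; last exact: vac_ctpow.
move=> [x _ [_ [Y1 IY1 [Z OZ <-]] <-]]; rewrite /ell.
have x1 := word1_ctpow x.
rewrite (tensDr _ _ x1) projD // (P_ell_orth _ _ OZ) addr0.
have [W nW WE] := IH Q' opQ' Q'n nQ' Y1 IY1.
(* [Q] shifts past the letter and becomes [Q']: the vector x (x) (Y1 - Q'Y1) has no component in
   degree n + 1, and [P] preserves degree. *)
rewrite (proj_onto_eq _ opQ _ _ (P (tens (word F [:: x]) (Q' Y1))) Qn nQ) //.
- rewrite -WE -P_tens //; exists (tens (word F [:: x]) W) => //.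
  by apply: (tens_tpow (m := 1)) => //; apply/tpow1P; exists x.
- by apply: P_ctpow; exact: (tens_ctpow (m := 1)).
move=> U nU; rewrite -projB // -(tensBr _ _ x1) proj_adj //.
have {nU} := P_ctpow _ _ nU.
move: (P U) => {}U nU; apply: ip_eq0C; move: U nU.
apply: ip_span_eq0 => _ [[|x' s] //= [sn] <-].
rewrite word_cons (ip_tens _ _ (word1_ctpow x') x1).
have ns : ctpow F n (word F s) by exact: words_ctpow.
have -> : ip F (word F s) (Y1 - Q' Y1) = 0; last by rewrite mulr0.
apply: ip_eq0C; rewrite -(nQ' _ ns) -proj_adj // projB // proj_idem //.
by rewrite subrr ip0l.
Qed.

(** Recovers [I] from [P] alone, so that the first situation of (c) takes the form of the second. *)
Lemma squeezing_image : I = P @` afock F.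
Proof.
have fpP := squeezing_fock_projection.
have [[[Hn [_ Hc _ IE]] _] _ _] := sqI.
apply/seteqP; split; last by move=> _ [X aX <-]; exact: image_sub_I.
rewrite [X in X `<=` _]IE fp_image_afock //; apply: lspan_mono => Y [n _ HnY].
exists n => //.
have [Q [opQ Qn nQ]] :=
  orthogonal_projection_exists (ctpow F n) (ctpow_lsubspace n) (ctpow_closed n).
rewrite -(nQ Y (Hc _ _ HnY)); apply: component_I => //.
by rewrite IE; apply: sub_lspan; exists n.
Qed.

End SqueezingExtension.

(** The extension is the projection onto the closure of [I]: the weak projection identity says that
    X - pX is orthogonal to the range of [p], which is [I]. *)
Lemma squeezing_extension_exists I p : projection_squeezing I p ->
  exists P, projection_extension (sqdom I) p P.
Proof.
move=> [[_ [_ _ pI _]] [lp _ pw] _].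
have sV : lsubspace (sqdom I) by exact: lspan_lsubspace.
have sI : lsubspace I by rewrite -pI; exact: linear_on_image.
have [P [opP PI IP]] :=
  orthogonal_projection_exists (closure I) (closure_lsubspace sI) (@closed_closure _ I).
exists P; split=> // X VX; apply: (proj_onto_eq _ opP (closure I)) => //.
  by apply: subset_closure; rewrite -pI; exists X.
move=> Z clZ; apply: ip_eq0C; move: Z clZ; apply: ip_closure_eq0.
rewrite -pI => _ [Y VY <-]; apply: ip_eq0C.
by rewrite ipBl pw // subrr.
Qed.

Lemma linear_continuous_bounded P : linear P -> continuous P ->
  bounded_linear setT P.
Proof.
move=> lP cP; have lP' : linear_on setT P by move=> a x y _ _; exact: lP.
split=> //; have P0 := linear_on0 lsubspaceT lP'.
have /cvgrPdist_lt /(_ 1 ltr01) : P x @[x --> (0 : F)] --> P 0 by exact: cP.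
rewrite P0 => /nbhs_ballP[d /= d0 dP].
exists (2 / d); first by rewrite divr_ge0 // ltW.
move=> X _; have [->|X0] := eqVneq X 0; first by rewrite P0 !normr0 mulr0.
have nX : 0 < `|X| by rewrite normr_gt0.
have cX : 0 < d / 2 / `|X| by rewrite !divr_gt0.
pose c := d / 2 / `|X|.
have /dP : ball (0 : F) d (c *: X).
  rewrite -ball_normE /= sub0r normrN normrZ gtr0_norm // divfK ?gt_eqF //.
  by rewrite ltr_pdivrMr // ltr_pMr // ltr1n.
rewrite sub0r normrN -[c *: X]addr0 lP P0 addr0 normrZ gtr0_norm // => h.
rewrite -(ler_pM2l cX) (le_trans (ltW h)) //.
rewrite [leRHS](_ : _ = 1) //; field.
by rewrite !gt_eqF.
Qed.

Lemma decreasing_is_fock_projection P : decreasing_fock_projection P ->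
  fock_projection P.
Proof.
move=> [[lP cP] [_ _ wP] [vP ctP] idP ldP].
have bP := linear_continuous_bounded P lP cP.
have bIP : bounded_linear setT (fun X => X - P X).
  exact: bounded_linearB (bounded_linear_id _) bP.
(* The identity is given on [afock F] only and extends by density in one argument at a time. Its
   right side is Hermitian symmetric, which makes [P] self-adjoint; idempotence then follows. *)
have PP X Y : ip F X (P Y) = ip F (P X) (P Y).
  apply/eqP; rewrite -subr_eq0 -ipBl; apply/eqP.
  have aF Z : closure (afock F) Z by rewrite closure_afock.
  have h Y' : afock F Y' -> ip F (X - P X) (P Y') = 0.
    move=> aY; have := aF X; move: X; apply: (bounded_linear_closure
      (lspan_lsubspace _) (bounded_linear_sub (@subsetT _ _) bIP)
      (ip_eq0_closed (P Y'))) => X aX /=.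
    by rewrite ipBl wP // subrr.
  apply: ip_eq0C; have := aF Y; move: Y; apply: (bounded_linear_closure
    (lspan_lsubspace _) (bounded_linear_sub (@subsetT _ _) bP)
    (ip_eq0_closed (X - P X))) => Y aY /=.
  by apply: ip_eq0C; exact: h.
have opP : orthogonal_projection P.
  have adj X Y : ip F (P X) Y = ip F X (P Y).
    by rewrite PP [LHS]ipC PP -ipC.
  by split=> // X; apply: ip_ext => Z; rewrite adj -PP adj.
have ctP' n X : ctpow F n X -> ctpow F n (P X).
  move: X; apply: (ctpow_ind (bounded_linear_sub (@subsetT _ _) bP)
    (ctpow_lsubspace n) (ctpow_closed n)) => s sn.
  by apply: ctP; [apply: sub_lspan; exists s|exact: words_ctpow].
split=> //; exact/left_decreasingP.
Qed.

Lemma fock_projection_interacting P : fock_projection P ->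
  interacting_fock (P @` afock F) P.
Proof.
move=> fpP; have opP := fp_proj _ fpP; have ctP := fp_ctpow _ fpP.
have sa : lsubspace (afock F) by exact: lspan_lsubspace.
have sI : lsubspace (P @` afock F) by exact: fp_image_lsubspace.
have lP : forall A, linear_on A P by move=> A; exact: (proj_bounded_linear _ opP A).1.
have P0 Z : orth (P @` afock F) Z -> P Z = 0.
  move=> OZ; apply: ip_ext => Y; rewrite ip0l.
  have : closure (afock F) Y by rewrite closure_afock.
  move=> clY; apply: ip_eq0C; move: Y clY; apply: ip_closure_eq0 => Y aY.
  by rewrite -proj_adj //; apply: ip_eq0C; apply: OZ; exists Y.
have vacI : (P @` afock F) (vac F).
  by exists (vac F); [apply: sub_lspan; exists [::]|exact: fp_vac].
have O0 : orth (P @` afock F) 0 by exact: (orth_lsubspace _).1.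
split.
  exists (fun n => P @` tpow F n); split.
  - by move=> n; exact: fp_image_lsubspace (lspan_lsubspace _).
  - by move=> n; exact: fp_tpow_ctpow.
  - rewrite tpow0; apply/seteqP; split=> [_ [X X0 <-]|X X0].
      by rewrite fp_ctpow0 // ctpow0.
    by exists X => //; rewrite fp_ctpow0 // ctpow0.
  - exact: fp_image_afock.
split=> //.
- by split; [exact: fp_vac|move=> n X _; exact: ctP].
- apply/seteqP; split.
    move=> _ [X VX <-]; move: X VX; apply: linear_on_lspan sI; first exact: lP.
    move=> _ [[x _ [_ [_ [Y aY <-] [Z OZ <-]] <-]]|->]; last first.
      by rewrite fp_vac.
    rewrite /ell fp_tens //; last exact: word1_ctpow.
    (* The component [Z] disappears and the inner [P] is removed again, leaving the image of x (x)
       Y, which is algebraic. *)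
    rewrite projD // proj_idem // (P0 Z) // addr0 -fp_tens //; last exact: word1_ctpow.
    exists (tens (word F [:: x]) Y) => //; move: Y aY.
    apply: linear_on_lspan sa; first exact: (tens_bounded_linear _ (word1_ctpow x)).1.
    by move=> _ [s _ <-]; rewrite -word_cons; apply: sub_lspan; exists (x :: s).
  rewrite [X in X `<=` _]lspan_image //.
  apply: lspan_sub.
    by apply: linear_on_image => //; exact: lspan_lsubspace.
  move=> _ [_ [s _ <-] <-]; case: s => [|x s].
    by exists (vac F) => //; apply: sub_lspan; right.
  (* A preimage in the squeezing domain, since P s lies in the image; by [fp_tens] it has the same
     image as the word [x :: s]. *)
  exists (tens (word F [:: x]) (P (word F s))).
    apply: sub_lspan; left; exists x => //; exists (P (word F s)) => //.
    exists (P (word F s)); last by exists 0; [exact: O0|exact: addr0].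
    by exists (word F s) => //; apply: sub_lspan; exists s.
  by rewrite -(fp_tens _ fpP _ _ (word1_ctpow x)) (word_cons x s).
- move=> x X OX; rewrite /ell fp_tens //; last exact: word1_ctpow.
  rewrite (P0 _ OX) (tens0r (word1_ctpow x)).
  exact: linear_on0 lsubspaceT (lP _).
Qed.

End InteractingFockSpaces.

(** * Coisometric products and subproduct systems *)

Section CoisometricProducts.
Context {R : realType} {H : preHilbert R} {F : fockSpace H}.
Variables (P : F -> F) (fpP : fock_projection P).
Let opP : orthogonal_projection P := fp_proj P fpP.
Let ctP := fp_ctpow P fpP.
Implicit Types (X Y Z : F) (w : nat -> nat -> F -> F).

Lemma fp_image_tpow0 : P @` tpow F 0 = lspan [set vac F].
Proof.
rewrite tpow0 lspan_image; last exact: (proj_bounded_linear _ opP _).1.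
by rewrite image_set1 fp_vac.
Qed.

Lemma fp_image_ctpow0 : P @` ctpow F 0 = lspan [set vac F].
Proof. by rewrite ctpow0 -[in LHS]tpow0 fp_image_tpow0. Qed.

Lemma completed_products_right w :
  completed_coisometric_products P w -> right_decreasing P.
Proof.
move=> [cw wE]; apply/(right_decreasingP P fpP) => m n.
have [lw _ _] := cw m n.
exact: (contraction_product P fpP m n _ _ (@subset_closure _ _) lw
  (coisometry_contraction _ _ _ (cw m n)) (wE m n)).
Qed.

Lemma completed_productsP :
  (exists w, completed_coisometric_products P w) <-> right_decreasing P.
Proof.
split=> [[w]|/(right_decreasingP P fpP) PE]; first exact: completed_products_right.
exists (fun _ _ => P); split=> [m n|m n X Y mX nY].
  exact: completed_coisometry (PE m n).
by rewrite -(PE m n) //; exact: tpow_ctpow.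
Qed.

(** The inclusion is forced: a coisometry lifts Y to some X of the algebraic tensor product with the
    same norm, and wX = PX = Y. So [P] does not shorten X, hence fixes it, and Y = X. *)
Lemma algebraic_productsP :
  (exists w, coisometric_products P w) <->
  (right_decreasing P /\ forall m n, P @` tpow F (m + n)
     `<=` atens (P @` tpow F m) (P @` tpow F n)).
Proof.
split=> [[w [cw wE]]|[/(right_decreasingP P fpP) PE PG]].
  have wn m n := coisometry_contraction _ _ _ (cw m n).
  split.
    apply/(right_decreasingP P fpP) => m n; have [lw _ _] := cw m n.
    exact: (contraction_product P fpP m n _ _ (fun _ h => h) lw (wn m n) (wE m n)).
  move=> m n Y PY; have [lw _ _] := cw m n.
  have [X GX [wX XY]] := coisometry_lift _ _ _ (cw m n) Y PY.
  have PXY : P X = Y.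
    by rewrite -wX -(product_eq_proj P fpP m n _ _ (fun _ h => h) lw (wn m n) (wE m n)).
  suff : P X = X by rewrite PXY => ->.
  by apply: norm_proj_fixed => //; rewrite PXY XY.
exists (fun _ _ => P); split=> [m n|m n X Y mX nY].
  exact: algebraic_coisometry (PE m n) (PG m n).
by rewrite -(PE m n) //; exact: tpow_ctpow.
Qed.

Section Completed.
Variables (w : nat -> nat -> F -> F) (cw : completed_coisometric_products P w).

Lemma completed_product_proj m n X :
  closure (atens (P @` tpow F m) (P @` tpow F n)) X -> w m n X = P X.
Proof.
have [lw _ _] := cw.1 m n; have wn := coisometry_contraction _ _ _ (cw.1 m n).
apply: bounded_linear_ext.
- by split=> //; exists 1 => // Y GY; rewrite mul1r; exact: wn.
- exact: proj_bounded_linear.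
move=> Y GY; apply: (product_eq_proj P fpP m n _ (w m n)
  (@subset_closure _ _) lw wn (cw.2 m n)).
exact: sub_lspan.
Qed.

Lemma completed_product_tens m n X Y :
  (P @` ctpow F m) X -> (P @` ctpow F n) Y -> w m n (tens X Y) = P (tens X Y).
Proof.
move=> mX nY; apply: completed_product_proj; rewrite -closure_atens_image //.
by apply: subset_closure; apply: sub_lspan; exists X => //; exists Y.
Qed.

Lemma completed_subproduct_system :
  subproduct_system (fun n => P @` ctpow F n) w.
Proof.
have /(right_decreasingP P fpP) PE := completed_products_right w cw.
have KP n X : (P @` ctpow F n) X -> ctpow F n X /\ P X = X.
  by move/(fp_imageP P fpP).
split.
- move=> n; split; [exact: fp_image_lsubspace (ctpow_lsubspace n)
    |exact: fp_image_closed|by move=> X /KP[]].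
- exact: fp_image_ctpow0.
- move=> m n; rewrite closure_atens_image // -[P @` ctpow F (m + n)]closure_fp_image //.
  exact: cw.1.
- move=> l m n X Y Z lX mY nZ.
  have [cX _] := KP _ _ lX; have [cY _] := KP _ _ mY; have [cZ PZ] := KP _ _ nZ.
  have KT k j U V : ctpow F k U -> ctpow F j V ->
      (P @` ctpow F (k + j)) (P (tens U V)).
    by move=> kU jV; exists (tens U V) => //; exact: tens_ctpow.
  rewrite (completed_product_tens l m) // (completed_product_tens m n) //.
  rewrite !completed_product_tens //; [|exact: KT|exact: KT].
  (* Both bracketings equal P(X (x) Y (x) Z): left absorption serves the one, the right-hand
     inequality with PZ = Z the other. *)
  rewrite -(fp_left_absorb P fpP l) // -(tensA _ cX cY).
  have PE' := PE _ _ _ _ (tens_ctpow cX cY) cZ.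
  by rewrite PE' PZ.
- move=> n X nX; have [cX PX] := KP _ _ nX.
  have K0 : (P @` ctpow F 0) (vac F).
    by rewrite fp_image_ctpow0; exact: sub_lspan.
  by rewrite !completed_product_tens // tens_vac (tens_vac_r cX).
Qed.

(** Creators range over [tpow F 1], that is over H itself, so the spans stay algebraic. As [P] is
    the identity in degree one, the product formula applies with a letter as left factor. *)
Lemma created_image n : created w (tpow F 1) n = P @` tpow F n.
Proof.
elim: n => [|n IH] /=; first by rewrite fp_image_tpow0.
have wE x X : tpow F 1 x -> tpow F n X -> w 1%N n (tens x (P X)) = P (tens x X).
  move=> x1 nX; rewrite -(cw.2 1%N n _ _ x1 nX) (fp_ctpow1 P fpP x) //.
  exact: tpow_ctpow.
rewrite IH; apply/seteqP; split.
  apply: lspan_sub; first exact: fp_image_lsubspace (lspan_lsubspace _).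
  move=> _ [x x1 [_ [X nX <-] <-]]; rewrite wE //.
  by exists (tens x X) => //; exact: (tens_tpow (m := 1)).
rewrite /tpow /gen_tpow lspan_image; last exact: (proj_bounded_linear _ opP _).1.
apply: lspan_mono => _ [_ [[//|x s] /= [sn] <-] <-].
have x1 : tpow F 1 (word F [:: x]) by apply/tpow1P; exists x.
have ns : tpow F n (word F s) by apply: sub_lspan; exists s.
exists (word F [:: x]) => //; exists (P (word F s)); first by exists (word F s).
by rewrite wE // tens_word.
Qed.

Lemma completed_associated_fock :
  associated_fock w (tpow F 1) (P @` afock F) (fun x X => P (tens x X)).
Proof.
split.
  rewrite fp_image_afock //; congr (lspan _).
  by apply: eq_bigcupr => n _; rewrite created_image.
move=> n x X x1; rewrite created_image => nX.
rewrite completed_product_tens //; last exact: fp_tpow_image nX.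
exists x; first exact: tpow_ctpow.
by apply: fp_ctpow1 => //; exact: tpow_ctpow.
Qed.

(** For complete H the first member of the subproduct system is H, and the creators of the system
    are those of the interacting Fock space. *)
Lemma image_ctpow1_complete : hilbert H -> P @` ctpow F 1 = tpow F 1.
Proof.
move=> hH; rewrite -(ctpow1_complete hH); apply/seteqP; split=> X.
  by move/(fp_imageP P fpP) => [].
by move=> X1; exists X => //; exact: fp_ctpow1.
Qed.

End Completed.
End CoisometricProducts.

Theorem theorem7p5 (R : realType) (H : preHilbert R) (F : fockSpace H) :
  (* (a) *)
  (forall (I : set F) (p : F -> F), projection_squeezing I p ->
     (exists P, projection_extension (sqdom I) p P)
     /\ forall P, projection_extension (sqdom I) p P -> left_decreasing P)
  /\
  (* (b) *)
  (forall P : F -> F, decreasing_fock_projection P ->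
     interacting_fock (P @` afock F) P)
  /\
  (* (c) *)
  (forall (I : set F) (P : F -> F),
     (exists2 p, projection_squeezing I p
               & projection_extension (sqdom I) p P)
     \/ (decreasing_fock_projection P /\ I = P @` afock F) ->
     [/\ (exists w, completed_coisometric_products P w) <-> right_decreasing P,
         (exists w, coisometric_products P w) <->
           (right_decreasing P /\
            forall m n, P @` tpow F (m + n)
              `<=` atens (P @` tpow F m) (P @` tpow F n))
       & forall w, completed_coisometric_products P w ->
           [/\ subproduct_system (fun n => P @` ctpow F n) w,
               associated_fock w (tpow F 1) I (fun x X => P (tens x X))
             & hilbert H ->
               associated_fock w (P @` ctpow F 1) I
                 (fun x X => P (tens x X))]]).
Proof.
split=> [I p sqI|].
  split=> [|P extP]; first exact: squeezing_extension_exists.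
  have fpP := squeezing_fock_projection I p P sqI extP.
  apply/left_decreasingP; [exact: fp_proj|exact: fp_ctpow|exact: fp_tens].
split=> [P /decreasing_is_fock_projection|I P hP].
  exact: fock_projection_interacting.
have [fpP IE] : fock_projection P /\ I = P @` afock F.
  case: hP => [[p sqI extP]|[dP IE]].
    by split; [exact: squeezing_fock_projection sqI extP|exact: squeezing_image sqI extP].
  by split=> //; exact: decreasing_is_fock_projection.
split; [exact: completed_productsP|exact: algebraic_productsP|move=> w cw].
rewrite IE; split=> [||/(image_ctpow1_complete P fpP) ->].
- exact: completed_subproduct_system.
- exact: completed_associated_fock.
- exact: completed_associated_fock.
Qed.
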